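(* There exists a real number $\epsilon>0$ such that every digraph $D$ satisfies $$\vec{\chi}(D)\leq \left\lceil (1-\epsilon)\bigl(\tilde{\Delta}(D)+1\bigr)+\epsilon\,\overleftrightarrow{\omega}(D)\right\rceil .$$
   Context: Digraphs are finite, without loops and without parallel arcs (two opposite arcs $uv$ and $vu$ are allowed and form a digon). For a vertex $v$, $d^+(v)$ and $d^-(v)$ are its out-degree and in-degree, and $\tilde{\Delta}(D)=\max_{v\in V(D)}\sqrt{d^+(v)\cdot d^-(v)}$. A biclique of $D$ is a set of vertices that are pairwise linked by two arcs in opposite directions; $\overleftrightarrow{\omega}(D)$ is the maximum size of a biclique of $D$. The dichromatic number $\vec{\chi}(D)$ is the least $k$ such that $V(D)$ can be partitioned into $k$ (possibly empty) sets each inducing an acyclic subdigraph of $D$ (i.e. one without directed cycles; a digon is a directed cycle of length 2). *)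

(* Defs.v *)
From HB Require Import structures.
From mathcomp Require Import all_boot all_order all_algebra.
From mathcomp Require Import boolp reals.

Set Implicit Arguments.
Unset Strict Implicit.
Unset Printing Implicit Defensive.

Import Order.TTheory GRing.Theory Num.Theory.

Local Open Scope ring_scope.

(* [arc] being a relation rules out parallel arcs, but allows digons. *)
Record digraph := Digraph {
  vertex :> finType;
  arc : rel vertex;
  arc_irr : irreflexive arc }.

Definition outdeg (D : digraph) (v : D) : nat := #|[set w | arc v w]|.
Definition indeg (D : digraph) (v : D) : nat := #|[set w | arc w v]|.

(* The default value 0 matters only for the digraph without vertices. *)
Definition max_geom_deg (R : realType) (D : digraph) : R :=
  \big[Num.max/0]_(v : D) Num.sqrt (outdeg v * indeg v)%N%:R.

Definition biclique (D : digraph) (B : {set D}) : bool :=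
  [forall u in B, forall v in B, (u != v) ==> arc u v && arc v u].

Definition biclique_number (D : digraph) : nat :=
  \max_(B : {set D} | biclique B) #|B|.

Definition induced (D : digraph) (S : {set D}) : digraph :=
  @Digraph {v : D | v \in S} (fun u v => arc (val u) (val v))
           (fun u => arc_irr (val u)).

(* [cycle arc [::]] holds, so a directed cycle is a nonempty list [c]. *)
Definition acyclic (D : digraph) : Prop :=
  forall c : seq D, c != [::] -> uniq c -> ~~ cycle (@arc D) c.

(* The k parts are the fibres of f. *)
Definition dicolorable (D : digraph) (k : nat) : bool :=
  [exists f : {ffun D -> 'I_k},
     [forall i : 'I_k, `[< acyclic (induced [set v | f v == i]) >]]].

Lemma dicolorable_exists (D : digraph) : exists k, dicolorable D k.
Proof.
exists #|D|; apply/existsP; exists [ffun v => enum_rank v].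
apply/forallP => i; apply/asboolP => -[|u [|v c]] //= _.
  by rewrite arc_irr.
rewrite inE negb_or => /andP[/andP[/eqP uv _] _]; case: uv.
apply: val_inj; apply: enum_rank_inj.
move: (valP u) (valP v); rewrite !inE !ffunE.
by move=> /eqP -> /eqP ->.
Qed.

Definition dichromatic_number (D : digraph) : nat :=
  ex_minn (dicolorable_exists D).

(* Main.v *)
Require Import Defs.
From mathcomp Require Import all_boot all_order all_algebra.
From mathcomp Require Import boolp reals.
From mathcomp Require Import zify ring lra.
Import Defs.

Set Implicit Arguments.
Unset Strict Implicit.
Unset Printing Implicit Defensive.

Import Order.TTheory GRing.Theory Num.Theory.

(** Let [D] be a counterexample with fewest vertices, [w] its biclique number and
    [k] the bound. Deleting any set of vertices leaves a [k]-dicolorable digraph,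
    so all in- and out-degrees are at least [k]; as their products are at most the
    square of the geometric degree, they all lie in a narrow window above [k], and
    [k] is large.

    If [w] is close to [k], the maximum bicliques fall into clusters, each with a
    large common core (Hajnal), and the cores have a stable transversal. A maximal
    acyclic set containing it meets every maximum biclique and both neighbourhoods
    of every other vertex: removing it lowers [w] and the geometric degree by 1, and
    one more color suffices.

    Otherwise, an out-neighbourhood with few non-digon pairs would contain a dense
    set [K] of about [k] vertices, and a coloring of [D - K] would extend to [K],
    coloring many disjoint non-digon pairs monochromatically. So each
    out-neighbourhood has a positive proportion of non-digon pairs. Take [m] random
    sparse vertex sets, independent of each other, and keep in each of them the
    vertices that lie on no directed cycle for a local reason. By the local lemma,
    every vertex sees many of these sets twice in its out-neighbourhood, while few
    of its out-neighbours lie in several sets. The coloring by these sets then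
    extends greedily. *)

(** * Acyclic sets and greedy coloring *)

Lemma map_val_insub (T : eqType) (P : pred T) (sT : subEqType P) (c : seq T) :
  all P c -> map val (pmap (insub : T -> option sT) c) = c.
Proof.
move=> /allP cP; rewrite (pmap_filter (insubK _)); apply/all_filterP/allP => x /cP Px.
by rewrite /= insubT.
Qed.

Section Acyclic.
Variable D : digraph.
Implicit Types (S T : {set D}) (u v x y : D).

Definition outn v : {set D} := [set w | arc v w].
Definition inn v : {set D} := [set w | arc w v].

(** Acyclicity of the subdigraph induced by [S], stated inside [D] so that vertex sets can be
    compared without changing the type. *)
Definition acyclic_in S : Prop :=
  forall c : seq D, c != [::] -> uniq c -> {subset c <= S} -> ~~ cycle (@arc D) c.

Lemma acyclic_induced S : acyclic (induced S) <-> acyclic_in S.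
Proof.
split=> acS c c0 uc.
- move=> cS.
  have Ec : map val (pmap (insub : D -> option {v | v \in S}) c) = c.
    by apply: map_val_insub; apply/allP.
  have := acS (pmap insub c).
  rewrite -[cycle _ _]cycle_map Ec; apply.
    by apply: contra c0 => /eqP E; rewrite -Ec E.
  by rewrite -(map_inj_uniq val_inj) Ec.
- have := acS (map val c); rewrite cycle_map; apply.
  + by case: c c0 {uc}.
  + by rewrite (map_inj_uniq val_inj).
  + by move=> _ /mapP[x _ ->]; exact: valP.
Qed.

Lemma acyclic_inS S T : S \subset T -> acyclic_in T -> acyclic_in S.
Proof. by move=> /subsetP ST acT c c0 uc cS; apply: acT => // x /cS /ST. Qed.

Lemma acyclic_in0 : acyclic_in set0.
Proof. by move=> [|x c] // _ _ /(_ x (mem_head _ _)); rewrite inE. Qed.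

Lemma acyclic_in_stable S :
  {in S &, forall x y, ~~ arc x y} -> acyclic_in S.
Proof.
move=> stS [//|x c] _ _ cS; apply/negP => cyc.
have nS : next (x :: c) x \in S by apply: cS; rewrite mem_next mem_head.
by have := stS _ _ (cS x (mem_head _ _)) nS; rewrite (next_cycle cyc) ?mem_head.
Qed.

(** As there are no loops, a directed cycle through [v] contains both an out-neighbour and an
    in-neighbour of [v] in [S]. *)
Lemma acyclic_inU1 v S :
    acyclic_in S ->
    [disjoint S & outn v] || [disjoint S & inn v] -> acyclic_in (v |: S).
Proof.
move=> acS dis c c0 uc cS; have [vc|vc] := boolP (v \in c); last first.
  apply: acS => // x xc; have:= cS x xc; rewrite !inE => /predU1P[xv|//].
  by rewrite -xv xc in vc.
apply/negP => cyc; case/orP: dis => /disjoint_setI0 /setP dis.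
- have a := next_cycle cyc vc.
  have := cS (next c v); rewrite mem_next !inE => /(_ vc) /predU1P[E|nS].
    by rewrite E arc_irr in a.
  by have:= dis (next c v); rewrite !inE nS a.
- have a := prev_cycle cyc vc.
  have := cS (prev c v); rewrite mem_prev !inE => /(_ vc) /predU1P[E|nS].
    by rewrite E arc_irr in a.
  by have:= dis (prev c v); rewrite !inE nS a.
Qed.

Section Colorings.
Variable k : nat.
Implicit Types f g : D -> 'I_k.

Definition dicoloring S f : Prop :=
  forall i, acyclic_in [set v in S | f v == i].

Lemma dicolorableP :
  reflect (exists f : D -> 'I_k, dicoloring setT f) (dicolorable D k).
Proof.
apply: (iffP existsP) => -[f fP].
- exists f => i; move/forallP/(_ i)/asboolP/acyclic_induced: fP.
  by apply: acyclic_inS; apply/subsetP => x; rewrite !inE.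
- exists (finfun f); apply/forallP => i; apply/asboolP/acyclic_induced.
  by apply: acyclic_inS (fP i); apply/subsetP => x; rewrite !inE ffunE.
Qed.

Definition recolor f v (i : 'I_k) := fun x => if x == v then i else f x.

Lemma dicoloring_add S f v i :
    dicoloring S f -> v \notin S ->
    (forall x, x \in S -> arc v x -> f x != i) \/
      (forall x, x \in S -> arc x v -> f x != i) ->
  dicoloring (v |: S) (recolor f v i).
Proof.
move=> fS vS free l; have [->|il] := eqVneq l i; last first.
  apply: acyclic_inS (fS l); apply/subsetP => x; rewrite !inE /recolor.
  by case: (x == v) => //=; rewrite eq_sym (negPf il).
have: acyclic_in (v |: [set x in S | f x == i]).
  apply: acyclic_inU1 => //; apply/orP; case: free => free; [left|right];
    rewrite disjoint_subset; apply/subsetP => x; rewrite !inE => /andP[xS fx];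
    by apply/negP => /(free x xS); rewrite fx.
apply: acyclic_inS; apply/subsetP => x; rewrite !inE /recolor.
by case: eqP.
Qed.

Lemma exists_free_color (C : {set 'I_k}) : #|C| < k -> exists i, i \notin C.
Proof.
move=> lt; have/card_gt0P[i] : 0 < #|~: C|.
  by have := cardsC C; rewrite card_ord; lia.
by rewrite inE; exists i.
Qed.

(** An uncolored vertex only has to avoid the colors of its colored out-neighbours. Coloring one of
    its out-neighbours lowers the second summand by 1 and raises the first by at most 1, so the
    condition persists. *)
Lemma greedy_dicoloring S f :
    dicoloring S f ->
    (forall v, v \notin S ->
      #|f @: (outn v :&: S)| + #|outn v :\: S| < k) ->
  dicolorable D k.
Proof.
have [n] := ubnP #|~: S|; elim: n S f => // n IH S f ltn fS free.
have [E|[v vS]] := set_0Vmem (~: S).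
  by apply/dicolorableP; exists f; rewrite -[setT]setC0 -E setCK.
rewrite inE in vS.
have [|i ifree] := @exists_free_color (f @: (outn v :&: S)).
  by apply: leq_ltn_trans (free v vS); rewrite leq_addr.
have gS : dicoloring (v |: S) (recolor f v i).
  apply: dicoloring_add => //; left=> x xS vx; apply: contraNneq ifree => <-.
  by apply: imset_f; rewrite !inE vx.
apply: (IH _ _ _ gS).
  rewrite setCU setIC -setDE; have := cardsD1 v (~: S).
  by rewrite inE vS /=; lia.
move=> u; rewrite !inE negb_or => /andP[uv uS]; apply: leq_trans (free u uS).
rewrite ltnS; have [uav|nuav] := boolP (arc u v).
- have -> : #|outn u :\: S| = (#|outn u :\: (v |: S)|).+1.
    rewrite (cardsD1 v) !inE uav vS add1n; congr _.+1.
    by apply: eq_card => x; rewrite !inE; case: (x == v).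
  rewrite addnS -addSn leq_add2r.
  apply: leq_trans (_ : #|i |: f @: (outn u :&: S)| <= _); last first.
    by rewrite cardsU1 -add1n leq_add2r leq_b1.
  apply/subset_leq_card/subsetP => _ /imsetP[x + ->]; rewrite !inE /recolor.
  case: eqP => [_ _|_]; first by rewrite eqxx.
  by move=> /andP[ux /= xS]; rewrite imset_f ?orbT // !inE ux.
- apply: leq_add; apply/subset_leq_card/subsetP.
  + move=> _ /imsetP[x + ->]; rewrite !inE /recolor.
    case: eqP => [->|_]; first by rewrite (negPf nuav).
    by move=> xP; rewrite imset_f // !inE.
  + by move=> x; rewrite !inE negb_or; case: (x == v).
Qed.

End Colorings.
End Acyclic.

(** * Dense vertex sets *)

Section Dense.
Variable D : digraph.
Implicit Types (S K : {set D}) (u v x y : D).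

(** Nonadjacency in the undirected graph of digons, whose cliques are the bicliques. *)
Definition nondigon x y := (x != y) && ~~ (arc x y && arc y x).

Lemma nondigonC x y : nondigon x y = nondigon y x.
Proof. by rewrite /nondigon eq_sym andbC [arc x y && _]andbC andbC. Qed.

Lemma biclique_numberP S : biclique S -> #|S| <= biclique_number D.
Proof. by move=> bS; rewrite /biclique_number (bigD1 S) //= leq_maxl. Qed.

Lemma exists_nondigon S :
  biclique_number D < #|S| -> exists x y, [/\ x \in S, y \in S & nondigon x y].
Proof.
move=> lt; have: ~~ biclique S by apply: contraL lt => /biclique_numberP; lia.
rewrite negb_forall => /existsP[x]; rewrite negb_imply => /andP[xS].
rewrite negb_forall => /existsP[y]; rewrite negb_imply => /andP[yS].
by rewrite negb_imply => xy; exists x, y.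
Qed.

(** While more than [biclique_number D] vertices of [K] are uncolored, two of them form no digon.
    Each sees at most [a] colors outside [K] and at most [j] inside, those of [C], so some color is
    free for both. *)
Lemma merge_nondigons k K (f : D -> 'I_k) a j :
    dicoloring (~: K) f -> {in K, forall u, #|outn u :\: K| <= a} ->
    2 * (a + j) <= k -> biclique_number D + 2 * j <= #|K| ->
  exists S (g : D -> 'I_k) (C : {set 'I_k}),
    [/\ ~: K \subset S, dicoloring S g, #|K :\: S| + 2 * j = #|K|,
        #|C| <= j & forall x, x \in K :&: S -> g x \in C].
Proof.
move=> fK ext; elim: j => [|j IH] lek lew.
  exists (~: K), f, set0; split=> //; last by move=> x; rewrite setICr inE.
    by rewrite muln0 addn0 setDE setCK setIid.
  by rewrite cards0.
have [||S [g [C [KS gS cKS leC gC]]]] := IH; [lia|lia|].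
have [|x [y [xKS yKS nd]]] := @exists_nondigon (K :\: S); first by lia.
(* As [y] is colored after [x], it may repeat the color of [x] when [x] is not among its
   out-neighbours. *)
wlog nyx : x y xKS yKS nd / ~~ arc y x.
  move=> WL; have := nd; rewrite {1}/nondigon negb_and => /andP[_ /orP[]] n.
    by apply: WL n => //; rewrite nondigonC.
  exact: WL n.
have {nd} xy : x != y by case/andP: nd.
move: xKS yKS; rewrite !inE => /andP[xS xK] /andP[yS yK].
have card_colors u : u \in K -> #|g @: (outn u :&: S)| <= a + j.
  move=> uK; apply: leq_trans (_ : #|(g @: (outn u :\: K)) :|: C| <= _).
    apply/subset_leq_card/subsetP => _ /imsetP[z /setIP[zu zS] ->].
    rewrite inE; have [zK|zK] := boolP (z \in K).
      by rewrite gC ?orbT // inE zK.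
    by rewrite imset_f // !inE zK; rewrite inE in zu.
  apply: leq_trans (leq_card_setU _ _) (leq_add _ leC).
  exact: leq_trans (leq_imset_card _ _) (ext u uK).
have [|i] := @exists_free_color k (g @: (outn x :&: S) :|: g @: (outn y :&: S)).
  apply: leq_ltn_trans (leq_card_setU _ _) _.
  by apply: leq_ltn_trans (leq_add (card_colors x xK) (card_colors y yK)) _; lia.
rewrite inE negb_or => /andP[ix iy].
have g1 : dicoloring (x |: S) (recolor g x i).
  apply: dicoloring_add => //; left=> z zS xz; apply: contraNneq ix => <-.
  by apply: imset_f; rewrite !inE xz.
have g2 : dicoloring (y |: (x |: S)) (recolor (recolor g x i) y i).
  apply: dicoloring_add => //; first by rewrite !inE negb_or eq_sym xy.
  left=> z + yz; rewrite !inE /recolor => /predU1P[zx|zS].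
    by rewrite -zx yz in nyx.
  rewrite ifN; last by apply: contraNneq xS => <-.
  by apply: contraNneq iy => <-; apply: imset_f; rewrite !inE yz.
exists (y |: (x |: S)), (recolor (recolor g x i) y i), (i |: C); split=> //.
- by apply: subset_trans KS _; rewrite setUA subsetUr.
- have := cardsD1 x (K :\: S); have := cardsD1 y ((K :\: S) :\ x).
  rewrite !inE xS yS xK yK (eq_sym y) xy /=.
  have -> : (K :\: S) :\ x :\ y = K :\: (y |: (x |: S)).
    by apply/setP => z; rewrite !inE; case: (z == x); case: (z == y).
  by lia.
- by rewrite cardsU1 -add1n leq_add // leq_b1.
- move=> z; rewrite !inE /recolor; case: (z == y); first by rewrite eqxx.
  by case: (z == x) => /=; [rewrite eqxx | move=> zP; rewrite gC ?orbT ?inE].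
Qed.

(* Two vertices that do not form a digon may share a color; the [j] colors
   saved on such pairs make up for the arcs leaving [K]. *)
Lemma extend_to_dense k K (f : D -> 'I_k) a j :
    dicoloring (~: K) f -> {in K, forall u, #|outn u :\: K| <= a} ->
    2 * (a + j) <= k -> biclique_number D + 2 * j <= #|K| ->
    a + #|K| < k + j ->
  dicolorable D k.
Proof.
move=> fK ext lek lew lt.
have [S [g [C [KS gS cKS leC gC]]]] := merge_nondigons fK ext lek lew.
apply: (greedy_dicoloring gS) => v vS.
have vK : v \in K by apply: contraNT vS => vK; apply: (subsetP KS); rewrite inE.
have le1 : #|outn v :\: S| <= #|K :\: S|.
  apply/subset_leq_card/subsetP => z; rewrite !inE => /andP[zS _].
  by rewrite zS; apply: contraNT zS => zK; apply: (subsetP KS); rewrite inE.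
have le2 : #|g @: (outn v :&: S)| <= a + j.
  apply: leq_trans (_ : #|(g @: (outn v :\: K)) :|: C| <= _); last first.
    apply: leq_trans (leq_card_setU _ _) (leq_add _ leC).
    exact: leq_trans (leq_imset_card _ _) (ext v vK).
  apply/subset_leq_card/subsetP => _ /imsetP[z /setIP[zu zS] ->].
  rewrite inE; have [zK|zK] := boolP (z \in K).
    by rewrite gC ?orbT // inE zK.
  by rewrite imset_f // !inE zK; rewrite inE in zu.
by lia.
Qed.

End Dense.

(** * Non-digon pairs in out-neighbourhoods *)

Section SparseNeighbourhoods.
Variable D : digraph.
Implicit Types (S K : {set D}) (u v x y : D).

Definition nondigon_pairs v : {set D * D} :=
  [set p | [&& p.1 \in outn v, p.2 \in outn v & nondigon p.1 p.2]].

(** If the pairs were few, all but [t] out-neighbours of [v] would have at most [t] non-digon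
    partners in [outn v]. They form a set [K] that few arcs leave, to which [extend_to_dense]
    applies. *)
Lemma many_nondigon_pairs k t :
    (forall v, k <= #|outn v| <= k + t) ->
    (forall K, K != set0 -> exists f : D -> 'I_k, dicoloring (~: K) f) ->
    biclique_number D + 9 * t + 4 <= k -> 14 * t + 6 <= k ->
    ~~ dicolorable D k ->
  forall v, t.+1 ^ 2 <= #|nondigon_pairs v|.
Proof.
move=> deg crit lew let_ ncol v; apply: contraNT ncol; rewrite -ltnNge => few.
pose nd u := [set w in outn v | nondigon u w].
pose K := [set u in outn v | #|nd u| <= t].
have leKN : #|K| <= #|outn v|.
  by apply/subset_leq_card/subsetP => z; rewrite inE => /andP[].
have cardK : #|outn v :\: K| <= t.
  rewrite -ltnS -(ltn_pmul2r (ltn0Sn t)) mulnn.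
  apply: leq_ltn_trans few; rewrite -sum_nat_const.
  apply: leq_trans (_ : \sum_(u in outn v :\: K) #|nd u| <= _).
    apply: leq_sum => u; rewrite in_setD => /andP[+ uN].
    by rewrite inE uN -ltnNge.
  under eq_bigr do rewrite -sum1_card.
  rewrite pair_big_dep /= sum1_card; apply/subset_leq_card/subsetP => -[u w].
  by rewrite unfold_in !inE /= -!andbA => /and4P[_ -> -> ->].
have KN : #|outn v| <= #|K| + t.
  have := cardsID K (outn v); have := subset_leq_card (subsetIr (outn v) K); lia.
have /andP[dv1 dv2] := deg v.
have [|f fK] := crit K; first by rewrite -card_gt0; lia.
(* A vertex of [K] has at most [k + t] out-neighbours; these include all of [K] but at most [t + 1]
   vertices, itself among them, and [K] has at least [k - t]: hence [3 * t + 1]. As [K] has at most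
   [k + t] vertices, [4 * t + 2] colors must be saved. *)
apply: (@extend_to_dense D k K f (3 * t + 1) (4 * t + 2)) => //; try lia.
move=> u uK; have := cardsID K (outn u); have /andP[_ du] := deg u.
have le1 : #|K :\: outn u| <= t.+1.
  apply: leq_trans (_ : #|u |: nd u| <= _).
    apply/subset_leq_card/subsetP => z; rewrite !inE.
    move=> /andP[nuz /andP[vz _]]; rewrite vz /nondigon (negPf nuz) andbT (eq_sym u).
    by case: (z == u).
  move: uK; rewrite inE => /andP[_]; rewrite cardsU1.
  by case: (u \notin nd u) => /=; lia.
have := cardsID (outn u) K; rewrite (setIC K); lia.
Qed.
End SparseNeighbourhoods.

(** * Independent transversals *)

Lemma leq_card_bigcup (I T : finType) (P : pred I) (B : I -> {set T}) :
  #|\bigcup_(i | P i) B i| <= \sum_(i | P i) #|B i|.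
Proof.
elim/big_ind2: _ => [|A n C m leA leC|//]; first by rewrite cards0.
exact: leq_trans (leq_card_setU _ _) (leq_add leA leC).
Qed.

Lemma card_pair_set (I T : finType) (P : pred I) (B : I -> {set T}) :
  #|[set p | P p.1 && (p.2 \in B p.1)]| = \sum_(i | P i) #|B i|.
Proof.
under eq_bigr do rewrite -sum1_card.
by rewrite pair_big_dep /= -sum1_card; apply: eq_bigl => p; rewrite inE.
Qed.

Lemma card_setX_split (I J : finType) (A : {set I}) (B : {set J}) (P : I -> J -> bool) :
  #|A| * #|B| = #|[set p | [&& p.1 \in A, p.2 \in B & P p.1 p.2]]|
              + #|[set p | [&& p.1 \in A, p.2 \in B & ~~ P p.1 p.2]]|.
Proof.
rewrite -cardsX -[LHS](cardsID [set p | P p.1 p.2]).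
by congr (_ + _); apply: eq_card => -[u X]; rewrite !inE /= -?andbA //;
  do !bool_congr.
Qed.

Section IndependentTransversal.
Variables (V : finType) (e : rel V) (F : {set {set V}}) (a d : nat).
Hypotheses (e_irr : irreflexive e) (e_sym : symmetric e) (trivF : trivIset F).
Hypotheses (a_gt0 : 0 < a) (le_da : 4 * d <= a).
Hypothesis cardF : {in F, forall A : {set V}, a <= #|A|}.
Hypothesis degF : {in F, forall A : {set V}, {in A, forall u,
  #|[set z in cover F :\: A | e u z]| <= d}}.
Implicit Types (A X : {set V}) (G : {set {set V}}).

(** The inclusion in [cover G] makes such a set amount to a choice of one vertex per class, so that
    counting these sets counts stable choices. *)
Definition transversals G : {set {set V}} :=
  [set X : {set V} | [&& X \subset cover G, [forall A in G, #|X :&: A| == 1] &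
            [forall x in X, forall y in X, ~~ e x y]]].

Lemma transversalsP G X :
  reflect [/\ X \subset cover G, {in G, forall A : {set V}, #|X :&: A| = 1} &
              {in X &, forall x y, ~~ e x y}]
          (X \in transversals G).
Proof.
rewrite inE; apply: (iffP and3P) => -[XG X1 eX]; split=> //.
- by move=> A /(forall_inP X1)/eqP.
- by move=> x y xX yX; exact: (forall_inP (forall_inP eX x xX) y yX).
- by apply/forall_inP => A AG; apply/eqP/X1.
- by apply/forall_inP => x xX; apply/forall_inP => y yX; apply: eX.
Qed.

Lemma disjoint_cover G A :
  G \subset F -> A \in F -> A \notin G -> [disjoint cover G & A].
Proof.
move=> GF AF AG; rewrite disjoint_sym disjoints_subset.
apply/subsetP => x xA; rewrite inE; apply: contra AG => /bigcupP[B BG xB].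
have [->//|AB] := eqVneq A B.
have := trivIsetP trivF A B AF (subsetP GF B BG) AB.
by move/disjoint_setI0/setP/(_ x); rewrite !inE xA xB.
Qed.

(** Deleting [z] is injective on the sets that contain it, and [z] is their only vertex in [A]. *)
Lemma transversals_remove G A z :
    G \subset F -> A \in G -> z \in A ->
  #|[set X in transversals G | z \in X]| <= #|transversals (G :\ A)|.
Proof.
move=> GF AG zA.
have rmK : {in [set X in transversals G | z \in X], cancel (fun X => X :\ z) (fun X => z |: X)}.
  by move=> X; rewrite inE => /andP[_ zX]; exact: setD1K.
rewrite -(card_in_imset (can_in_inj rmK)).
apply/subset_leq_card/subsetP => _ /imsetP[X + ->]; rewrite inE.
move=> /andP[/transversalsP[XG X1 eX] zX].
have XA : X :&: A = [set z].
  apply/esym/eqP; rewrite eqEcard sub1set inE zX zA /=.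
  by rewrite X1 // cards1.
apply/transversalsP; split.
- apply/subsetP => x /setD1P[xz xX].
  have /bigcupP[B BG xB] := subsetP XG x xX.
  apply/bigcupP; exists B => //; rewrite in_setD1 BG andbT.
  apply: contraNneq xz => EB; rewrite -in_set1 -XA inE xX -EB //.
- move=> B /setD1P[BA BG]; rewrite -(X1 B BG); apply: eq_card => x.
  rewrite !inE; have [->|//] := eqVneq x z.
  have := trivIsetP trivF A B (subsetP GF A AG) (subsetP GF B BG).
  rewrite eq_sym => /(_ BA)/disjoint_setI0/setP/(_ z).
  by rewrite !inE zA /= => ->; rewrite andbF.
- by move=> x y /setD1P[_ xX] /setD1P[_ yX]; apply: eX.
Qed.

Lemma transversals_add G A u X :
    G \subset F -> A \in F -> A \notin G -> X \in transversals G -> u \in A ->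
    {in X, forall z, ~~ e u z} -> u |: X \in transversals (A |: G).
Proof.
move=> GF AF AG /transversalsP[XG X1 eX] uA euX.
have dis := disjoint_cover GF AF AG.
have XA x : x \in X -> x \notin A.
  by move=> /(subsetP XG) xG; have := disjointFr dis xG => ->.
apply/transversalsP; split.
- rewrite /cover bigcup_setU big_set1 subUset sub1set inE uA /=.
  exact: subset_trans XG (subsetUr _ _).
- move=> B /setU1P[->|BG].
    rewrite -(cards1 u); apply: eq_card => x; rewrite !inE.
    have [->|_] /= := eqVneq x u; first by rewrite uA.
    by apply/negP => /andP[/XA/negP].
  rewrite -(X1 B BG); apply: eq_card => x; rewrite !inE.
  have [->|//] /= := eqVneq x u.
  have /negPf-> : u \notin B; last by rewrite andbF.
  apply: contraTN uA => uB; rewrite (disjointFr dis) //.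
  by apply/bigcupP; exists B.
- move=> x y /setU1P[->|xX] /setU1P[->|yX]; first by rewrite e_irr.
  + exact: euX.
  + by rewrite e_sym euX.
  + exact: eX.
Qed.

(* Rosenfeld's counting: by induction, a vertex of a class of [G] belongs to at
   most a fraction [2 / a] of the transversals of [G], so the neighbours of [u]
   spoil at most half of the pairs [(u, X)]. *)
Lemma transversals_grow G A :
    G \subset F -> A \in F -> A \notin G ->
  a * #|transversals G| <= 2 * #|transversals (A |: G)|.
Proof.
have [n] := ubnP #|G|; elim: n G A => // n IH G A ltn GF AF AG.
set T := transversals G; set T' := transversals (A |: G).
have dis := disjoint_cover GF AF AG.
pose good := [set p : V * {set V} | [&& p.1 \in A, p.2 \in T & [forall z in p.2, ~~ e p.1 z]]].
pose bad := [set p : V * {set V} | [&& p.1 \in A, p.2 \in T & ~~ [forall z in p.2, ~~ e p.1 z]]].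
have card_all : #|A| * #|T| = #|good| + #|bad|.
  exact: (card_setX_split A T (fun u X => [forall z in X, ~~ e u z])).
have card_good : #|good| <= #|T'|.
  (* The pair is recovered from the union: [u] is its only vertex in [A]. *)
  have inj : {in good &, injective (fun p : V * {set V} => p.1 |: p.2)}.
    have XA (X : {set V}) x : X \in T -> x \in X -> x \notin A.
      by move=> /transversalsP[XG _ _] /(subsetP XG) xG; rewrite (disjointFr dis xG).
    move=> [u X] [v Y]; rewrite in_set => /and3P[/= uA XT _].
    rewrite in_set => /and3P[/= vA YT _] E.
    have uv : u = v.
      have : u \in v |: Y by rewrite -E setU11.
      by case/setU1P => // /(XA _ _ YT); rewrite uA.
    congr pair => //; apply/setP => x; move: E => /setP/(_ x); rewrite !inE -uv.
    have [->|//] := eqVneq x u => _.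
    have nu (Z : {set V}) : Z \in T -> u \in Z = false.
      by move=> ZT; apply: contraTF uA; apply: XA.
    by rewrite !nu.
  rewrite -(card_in_imset inj); apply/subset_leq_card/subsetP.
  move=> _ /imsetP[[u X] + ->]; rewrite in_set => /and3P[/= uA XT /forall_inP eX].
  exact: transversals_add.
have card_bad : a * #|bad| <= #|A| * (d * (2 * #|T|)).
  apply: (@leq_trans (a * \sum_(u in A) \sum_(z in [set z in cover F :\: A | e u z] | z \in cover G)
                          #|[set X in T | z \in X]|)).
    rewrite leq_mul2l; apply/orP; right.
    have -> : #|bad| = \sum_(u in A) #|[set X in T | ~~ [forall z in X, ~~ e u z]]|.
      by rewrite -card_pair_set; apply: eq_card => p; rewrite !inE.
    apply: leq_sum => u uA.
    apply: leq_trans (leq_card_bigcup _ _); apply/subset_leq_card/subsetP => X.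
    case/setIdP=> XT; rewrite negb_forall => /existsP[z].
    rewrite negb_imply negbK => /andP[zX euz].
    have /transversalsP[/subsetP/(_ z zX) zG _ _] := XT.
    apply/bigcupP; exists z; last by apply/setIdP.
    rewrite zG inE euz !inE (disjointFr dis zG) /= !andbT.
    have /bigcupP[B BG zB] := zG; apply/bigcupP; exists B => //.
    exact: (subsetP GF).
  rewrite big_distrr /= -sum_nat_const; apply: leq_sum => u uA.
  rewrite big_distrr /=.
  apply: (@leq_trans (\sum_(z in [set z in cover F :\: A | e u z] | z \in cover G) 2 * #|T|)).
    apply: leq_sum => z /andP[_ /bigcupP[B BG zB]].
    apply: (@leq_trans (a * #|transversals (G :\ B)|)).
      by rewrite leq_mul2l transversals_remove ?orbT.
    have := IH (G :\ B) B; rewrite setD1K // !inE eqxx; apply => //.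
    - by move: ltn; rewrite (cardsD1 B) BG.
    - by apply: subset_trans GF; rewrite subD1set.
    - exact: subsetP BG.
  rewrite sum_nat_const leq_mul2r; apply/orP; right.
  apply: leq_trans (degF AF uA); apply/subset_leq_card/subsetP => z.
  by rewrite unfold_in => /andP[].
have leA := cardF AF.
(* By [4 * d <= a], [card_bad] makes at most half of all pairs bad. *)
have: 2 * (a * (#|A| * #|T|)) <= 2 * (a * #|T'|) + a * #|A| * #|T| by nia.
have : a * #|T| <= #|A| * #|T| by rewrite leq_mul2r leA orbT.
nia.
Qed.

(** Starting from the empty transversal, each new class multiplies the count by at least [a / 2], so
    it stays positive. *)
Lemma independent_transversal : exists X : {set V},
  {in F, forall A : {set V}, #|X :&: A| = 1} /\ {in X &, forall x y, ~~ e x y}.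
Proof.
suff: forall n G, #|G| <= n -> G \subset F -> 0 < #|transversals G|.
  move=> /(_ _ F (leqnn _) (subxx _))/card_gt0P[X /transversalsP[_ X1 eX]].
  by exists X.
elim=> [|n IH] G.
  rewrite leqn0 cards_eq0 => /eqP-> _; apply/card_gt0P; exists set0.
  apply/transversalsP; split; rewrite ?sub0set // => ?; by rewrite inE.
have [->|[A AG]] := set_0Vmem G; first by move=> _; apply: IH; rewrite cards0.
move=> leG GF; have := @transversals_grow (G :\ A) A; rewrite setD1K // !inE eqxx.
have: 0 < #|transversals (G :\ A)|.
  apply: IH; last by apply: subset_trans GF; rewrite subD1set.
  by move: leG; rewrite (cardsD1 A) AG.
move=> pos /(_ (subset_trans (subD1set _ _) GF) (subsetP GF A AG) isT).
by nia.
Qed.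
End IndependentTransversal.

(** * Large bicliques *)

Section LargeBicliques.
Variables (D : digraph) (k t : nat).
Hypothesis deg : forall v : D, k <= #|outn v| <= k + t.
Hypothesis indeg_le : forall v : D, k <= #|inn v| <= k + t.
Hypothesis large : k < biclique_number D + 9 * t + 4.
Hypothesis kt : 100 * t + 50 <= k.
Implicit Types (B S I U : {set D}) (u v x y : D).
Local Notation w := (biclique_number D).

Definition max_biclique B : bool := biclique B && (#|B| == w).

Definition meets S T : bool := S :&: T != set0.

Lemma bicliqueP S :
  reflect {in S &, forall x y, x != y -> arc x y && arc y x} (biclique S).
Proof.
apply: (iffP forall_inP) => bS.
  by move=> x y xS yS; have /forall_inP/(_ y yS)/implyP := bS x xS.
by move=> x xS; apply/forall_inP => y yS; apply/implyP; apply: bS.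
Qed.

Lemma card_joined v U : {in U, forall x, x != v -> arc v x} -> #|U| <= k + t + 1.
Proof.
move=> vU; apply: leq_trans (_ : #|v |: outn v| <= _).
  apply/subset_leq_card/subsetP => x xU; rewrite !inE.
  by case: eqVneq => //= xv; apply: vU.
by rewrite cardsU1 addnC; have := deg v; case: (v \notin _) => /=; lia.
Qed.

Lemma card_max_biclique B : max_biclique B -> #|B| = w.
Proof. by case/andP => _ /eqP. Qed.

Lemma max_bicliqueP B :
  max_biclique B -> {in B &, forall x y, x != y -> arc x y && arc y x}.
Proof. by case/andP => /bicliqueP. Qed.

Lemma meetsC S T : meets S T = meets T S.
Proof. by rewrite /meets setIC. Qed.

(** A common vertex is joined to the whole union, which its degree therefore bounds. *)
Lemma card_meet B B' : max_biclique B -> max_biclique B' -> meets B B' ->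
  2 * w <= #|B :&: B'| + (k + t + 1).
Proof.
move=> mB mB' /set0Pn[v]; rewrite inE => /andP[vB vB'].
have := cardsUI B B'; rewrite (card_max_biclique mB) (card_max_biclique mB').
have : #|B :|: B'| <= k + t + 1; last by lia.
apply: (@card_joined v) => x; rewrite inE eq_sym => /orP[] xB vx.
  by case/andP: (max_bicliqueP mB vB xB vx).
by case/andP: (max_bicliqueP mB' vB' xB vx).
Qed.

Lemma meets_large S S' B : S \subset B -> S' \subset B ->
  #|B| < #|S| + #|S'| -> meets S S'.
Proof.
move=> SB S'B lt; rewrite /meets -card_gt0; have := cardsUI S S'.
have : #|S :|: S'| <= #|B| by apply: subset_leq_card; rewrite subUset SB.
by lia.
Qed.

(** By [card_meet], [B1] and [B3] each contain more than half of [B2]. Meeting is thus an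
    equivalence relation on maximum bicliques; its classes are the clusters. *)
Lemma meets_trans B1 B2 B3 :
    max_biclique B1 -> max_biclique B2 -> max_biclique B3 ->
  meets B1 B2 -> meets B2 B3 -> meets B1 B3.
Proof.
move=> m1 m2 m3 m12 m23.
have : meets (B1 :&: B2) (B3 :&: B2).
  apply: (meets_large (subsetIr _ _) (subsetIr _ _)).
  have := card_meet m1 m2 m12; have := card_meet m2 m3 m23.
  by rewrite (setIC B3) (card_max_biclique m2); lia.
rewrite /meets => /set0Pn[x]; rewrite !inE => /andP[/andP[x1 _] /andP[x3 _]].
by apply/set0Pn; exists x; rewrite inE x1.
Qed.

(* Hajnal's inequality survives the addition of [B'] because the biclique
   [I :|: (B' :&: U)] has at most [w] vertices. *)
Lemma hajnal B (l : seq {set D}) :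
    max_biclique B -> {in l, forall B', max_biclique B' && meets B' B} ->
  exists I U,
    [/\ I \subset B, {in l, forall B', I \subset B'}, B \subset U,
        {in I & U, forall x y, x != y -> arc x y && arc y x} &
        2 * w <= #|I| + #|U| /\ 2 * w <= #|I| + (k + t + 1)].
Proof.
move=> mB; elim: l => [|B' l IH] ml.
  exists B, B; split=> //; first exact: max_bicliqueP.
  have mBB : meets B B.
    by rewrite /meets setIid -card_gt0 (card_max_biclique mB); lia.
  have := card_meet mB mB mBB; rewrite setIid (card_max_biclique mB).
  by split; lia.
have [|I [U [IB Il BU jIU [le1 le2]]]] := IH.
  by move=> C Cl; apply: ml; rewrite inE Cl orbT.
have /andP[mB' mBB'] := ml B' (mem_head _ _).
exists (B' :&: I), (B' :|: U).
have I'B : B' :&: I \subset B by apply: subset_trans IB; rewrite subsetIr.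
have jI'U : {in B' :&: I & B' :|: U, forall x y, x != y -> arc x y && arc y x}.
  move=> x y; rewrite !inE => /andP[xB' xI] /orP[yB'|yU] xy.
    exact: (max_bicliqueP mB').
  exact: jIU.
have leU : #|I :|: (B' :&: U)| <= w.
  apply: biclique_numberP; apply/bicliqueP => x y.
  have IU : {subset I <= U} by apply/subsetP; apply: subset_trans BU.
  rewrite !inE => /orP[xI|/andP[xB' xU]] /orP[yI|/andP[yB' yU]] xy.
  - by apply: jIU => //; apply: IU.
  - exact: jIU.
  - by rewrite andbC; apply: jIU => //; rewrite eq_sym.
  - exact: (max_bicliqueP mB').
have E : I :&: (B' :&: U) = B' :&: I.
  apply/setP => x; rewrite !inE; case xI: (x \in I) => //=; last by rewrite andbF.
  by rewrite (subsetP BU) ?andbT // (subsetP IB).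
have := cardsUI I (B' :&: U); rewrite E => c1.
have := cardsUI B' U; rewrite (card_max_biclique mB') => c2.
have le1' : 2 * w <= #|B' :&: I| + #|B' :|: U| by lia.
split=> //.
- move=> C; rewrite inE => /predU1P[->|Cl]; first by rewrite subsetIl.
  by apply: subset_trans (Il C Cl); rewrite subsetIr.
- by apply: subset_trans BU _; rewrite subsetUr.
split=> //.
(* By the second inequality of the induction hypothesis and [card_meet], [I] and [B' :&: B] each
   fill more than half of [B]. A common vertex is joined to the whole new union, whose size is thus
   at most [k + t + 1]; this restores the second inequality. *)
have : meets (B' :&: B) I.
  apply: (meets_large (subsetIr _ _) IB).
  have := card_meet mB' mB mBB'; rewrite (card_max_biclique mB); lia.
case/set0Pn => v; rewrite !inE => /andP[/andP[vB' vB] vI].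
have : #|B' :|: U| <= k + t + 1; last by lia.
apply: (@card_joined v) => x xU; rewrite eq_sym => vx.
have vI' : v \in B' :&: I by rewrite inE vB'.
by case/andP: (jI'U v x vI' xU vx).
Qed.

(** The intersection of the cluster of [B]; by [core_eq] it does not depend on the
    representative. *)
Definition core B : {set D} :=
  [set x in B | [forall (B' : {set D} | max_biclique B' && meets B' B), x \in B']].

Lemma card_core B : max_biclique B -> 2 * w <= #|core B| + (k + t + 1).
Proof.
move=> mB.
have [|I [U [IB Il _ _ [_ le2]]]] :=
    @hajnal B (enum [pred B' : {set D} | max_biclique B' && meets B' B]) mB.
  by move=> B'; rewrite mem_enum.
apply: leq_trans le2 _; rewrite leq_add2r; apply/subset_leq_card/subsetP => x xI.
rewrite inE (subsetP IB) //=; apply/forall_inP => B' mB'.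
by apply: (subsetP (Il B' _)) => //; rewrite mem_enum.
Qed.

Lemma core_sub B : core B \subset B.
Proof. by apply/subsetP => x; rewrite inE => /andP[]. Qed.

Lemma core_subl B B' : max_biclique B' -> meets B' B -> core B \subset B'.
Proof.
by move=> m me; apply/subsetP => x; rewrite inE => /andP[_ /forall_inP]; apply; rewrite m.
Qed.

Lemma core_eq B B' :
  max_biclique B -> max_biclique B' -> meets B B' -> core B = core B'.
Proof.
wlog suff: B B' / max_biclique B -> max_biclique B' -> meets B B' -> core B \subset core B'.
  by move=> H m m' me; apply/eqP; rewrite eqEsubset !H // meetsC.
move=> m m' me; apply/subsetP => x xB; rewrite inE.
rewrite (subsetP (core_subl m' _) x xB) 1?meetsC //=.
apply/forall_inP => B'' /andP[m'' me'']; apply: (subsetP (core_subl m'' _) x xB).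
by apply: meets_trans me'' _ => //; rewrite meetsC.
Qed.

Lemma exists_stable_hitting : exists X : {set D},
  {in X &, forall x y, ~~ arc x y} /\
  (forall B, max_biclique B -> meets X B).
Proof.
pose F := [set core B | B in [pred B | max_biclique B]].
pose e : rel D := fun x y => arc x y || arc y x.
have eC : symmetric e by move=> x y; rewrite /e orbC.
have disj B B' x : max_biclique B -> max_biclique B' -> core B != core B' ->
    x \in core B' -> x \notin B.
  move=> m m' ne xB'; apply: contra ne => xB; apply/eqP/core_eq => //.
  by apply/set0Pn; exists x; rewrite inE xB (subsetP (core_sub B')).
(* Class sizes come from [card_core]. A vertex of [B] has [w - 1] of its at most [k + t] neighbours
   in either direction inside [B], which leaves at most [10 * t + 4] on each side for the other
   cores, all disjoint from [B]. *)
have [|||||||X [X1 eX]] := @independent_transversal D e F (2 * w - (k + t + 1)) (20 * t + 10).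
- by move=> x; rewrite /e arc_irr.
- exact: eC.
- apply/trivIsetP => _ _ /imsetP[B mB ->] /imsetP[B' mB' ->] ne.
  rewrite disjoint_sym disjoints_subset; apply/subsetP => x xB'; rewrite inE.
  by apply: contra (disj _ _ _ mB mB' ne xB'); apply: subsetP (core_sub B) x.
- by lia.
- by lia.
- by move=> _ /imsetP[B mB ->]; have := card_core mB; lia.
- move=> _ /imsetP[B mB ->] u uB.
  have {}uB := subsetP (core_sub B) u uB.
  apply: leq_trans (_ : #|(outn u :\: B) :|: (inn u :\: B)| <= _).
    apply/subset_leq_card/subsetP => z; rewrite inE => /andP[].
    rewrite in_setD => /andP[zB /bigcupP[_ /imsetP[B' mB' ->] zB'] euz].
    have zN : z \notin B.
      by apply: (disj _ _ _ mB mB' _ zB'); apply: contraNneq zB => ->.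
    by rewrite !inE zN.
  apply: leq_trans (leq_card_setU _ _) _.
  have Bo : #|B| <= #|outn u :&: B|.+1.
    rewrite (cardsD1 u) uB add1n ltnS; apply/subset_leq_card/subsetP => x.
    rewrite !inE eq_sym => /andP[ux xB]; rewrite xB andbT.
    by case/andP: (max_bicliqueP mB uB xB ux).
  have Bi : #|B| <= #|inn u :&: B|.+1.
    rewrite (cardsD1 u) uB add1n ltnS; apply/subset_leq_card/subsetP => x.
    rewrite !inE eq_sym => /andP[ux xB]; rewrite xB andbT.
    by case/andP: (max_bicliqueP mB uB xB ux).
  move: Bo Bi; rewrite (card_max_biclique mB).
  have := cardsID B (outn u); have := cardsID B (inn u).
  have := deg u; have := indeg_le u; lia.
exists X; split=> [x y xX yX|B mB].
  by have := eX x y xX yX; rewrite negb_or => /andP[].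
have /X1 : core B \in F by apply/imsetP; exists B.
move=> c1; rewrite /meets -card_gt0; apply: (@leq_trans #|X :&: core B|).
  by rewrite c1.
by apply/subset_leq_card/setIS/core_sub.
Qed.

(** By [acyclic_inU1], a vertex with no out-neighbour or no in-neighbour in a maximal acyclic set
    could be added to it. Starting from a stable hitting set takes care of the maximum bicliques. *)
Lemma exists_maximal_acyclic : exists I,
  [/\ acyclic_in I,
      forall v, v \notin I -> meets I (outn v) && meets I (inn v) &
      forall B, biclique B -> [disjoint B & I] -> #|B| < w].
Proof.
have [X [stX hitX]] := exists_stable_hitting.
have [|I /maxsetP[/asboolP acI maxI] XI] :=
    @maxset_exists _ (fun S => `[< acyclic_in S >]) X.
  by apply/asboolP/acyclic_in_stable.
exists I; split=> // [v vI|B bB dis].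
  apply: contraNT vI; rewrite negb_and !negbK !setI_eq0 => dis.
  have /maxI <- : `[< acyclic_in (v |: I) >] by apply/asboolP/acyclic_inU1.
    exact: setU11.
  exact: subsetUr.
have := biclique_numberP bB; rewrite leq_eqVlt => /predU1P[cB|//].
have /hitX : max_biclique B by rewrite /max_biclique bB cB eqxx.
case/set0Pn => x; rewrite inE => /andP[/(subsetP XI) xI xB].
by rewrite (disjointFr dis xB) in xI.
Qed.
End LargeBicliques.

(** * The local lemma *)

Section LocalLemma.
Variables (R : realFieldType) (V T : finType).
Local Notation Omega := {ffun V -> T}.
Implicit Types (S : {set V}) (B C : {set Omega}).
Local Open Scope ring_scope.

Definition depends_on S B : Prop :=
  forall f g : Omega, {in S, f =1 g} -> (f \in B) = (g \in B).

(** Independence under the uniform measure: exchanging the coordinates outside [S] between two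
    outcomes turns pairs in [B] and [C] into pairs whose first member lies in [B :&: C]. *)
Lemma card_independent S S' B C :
    depends_on S B -> depends_on S' C -> [disjoint S & S'] ->
  (#|B| * #|C| = #|B :&: C| * #|Omega|)%N.
Proof.
move=> dB dC dis.
pose mix (f g : Omega) : Omega := [ffun x => if x \in S then f x else g x].
pose swap (p : Omega * Omega) := (mix p.1 p.2, mix p.2 p.1).
have swapK : involutive swap.
  by move=> [f g]; congr pair; apply/ffunP => x; rewrite !ffunE /=; case: (x \in S).
rewrite -cardsX -cardsT -cardsX -(card_preimset _ (inv_inj swapK)).
apply: eq_card => -[f g]; rewrite !inE andbT /=.
rewrite (dB (mix f g) f); last by move=> x xS; rewrite ffunE xS.
rewrite (dC (mix g f) f) // => x xS'; rewrite ffunE.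
by rewrite (disjointFl dis xS').
Qed.

Variables (E : finType) (B : E -> {set Omega}) (S : E -> {set V}).
Variables (p : R) (d : nat).
Hypothesis dep : forall e, depends_on (S e) (B e).
Hypothesis prob : forall e, #|B e|%:R <= p * #|Omega|%:R.
Hypothesis deg : forall e, (#|[set u | ~~ [disjoint S e & S u]]| <= d)%N.
Hypothesis pd : 4%:R * p * d%:R <= 1.
Hypotheses (p_ge0 : 0 <= p) (d_gt0 : (0 < d)%N) (T_gt0 : (0 < #|T|)%N).

Let good (U : {set E}) : {set Omega} := [set f | [forall e in U, f \notin B e]].

Let depends_good (U : {set E}) : depends_on (\bigcup_(e in U) S e) (good U).
Proof.
move=> f g fg; rewrite !inE; apply: eq_forallb => e.
case eU: (e \in U) => //=; congr (~~ _); apply: dep => x xe.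
by apply: fg; apply/bigcupP; exists e.
Qed.

Let card_Omega_gt0 : (0 < #|Omega|)%N.
Proof. by rewrite card_ffun expn_gt0 T_gt0. Qed.

(** The conditional probability of [B e] given [good U] is at most [2 * p]. The events of [U2] are
    independent of [B e]; by induction the at most [d] others remove a fraction at most
    [2 * p * d <= 1 / 2] of [good U2], whence the factor 2. *)
Let good_bad (U : {set E}) e : #|good U :&: B e|%:R <= 2%:R * p * #|good U|%:R.
Proof.
have [n] := ubnP #|U|; elim: n U e => // n IH U e ltn.
pose U2 := [set u in U | [disjoint S e & S u]].
have U2U : U2 \subset U by apply/subsetP => u; rewrite inE => /andP[].
have goodS (U' U'' : {set E}) : U' \subset U'' -> good U'' \subset good U'.
  move=> /subsetP sub; apply/subsetP => f; rewrite !inE => /forall_inP fU.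
  by apply/forall_inP => u /sub; apply: fU.
have indep : #|good U2 :&: B e|%:R <= p * #|good U2|%:R.
  have dis : [disjoint \bigcup_(u in U2) S u & S e].
    rewrite disjoints_subset; apply/bigcupsP => u; rewrite inE => /andP[_].
    by rewrite disjoint_sym disjoints_subset.
  have := card_independent (depends_good (U := U2)) (@dep e) dis.
  move=> /(congr1 (fun m => m%:R : R)); rewrite !natrM => eqn.
  rewrite -(ler_pM2r (_ : 0 < #|Omega|%:R :> R)) ?ltr0n // -eqn.
  by rewrite mulrAC mulrC ler_wpM2r.
apply: (@le_trans _ _ #|good U2 :&: B e|%:R).
  by rewrite ler_nat; apply/subset_leq_card/setSI/goodS.
apply: le_trans indep _.
rewrite -mulrA mulrCA ler_wpM2l //.
have [EU|neU] := eqVneq U2 U.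
  by rewrite EU ler_peMl // ler1n.
have ltU : (#|U2| < n)%N.
  by apply: leq_trans (proper_card _) ltn; rewrite properEneq neU.
have : (#|good U2| <= #|good U| + \sum_(u in U :\: U2) #|good U2 :&: B u|)%N.
  apply: leq_trans (_ : #|good U :|: \bigcup_(u in U :\: U2) (good U2 :&: B u)| <= _)%N.
    apply/subset_leq_card/subsetP => f fU2; rewrite inE.
    have [//|/=] := boolP (f \in good U); rewrite inE negb_forall.
    move=> /existsP[u]; rewrite negb_imply negbK => /andP[uU fu].
    apply/bigcupP; exists u; last by rewrite inE fU2.
    rewrite in_setD uU andbT; apply: contraL fu => uU2.
    by move: fU2; rewrite inE => /forall_inP; apply.
  by apply: leq_trans (leq_card_setU _ _) _; rewrite leq_add2l leq_card_bigcup.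
rewrite -(ler_nat R) natrD natr_sum => le1.
have le2 : \sum_(u in U :\: U2) #|good U2 :&: B u|%:R <= d%:R * (2%:R * p * #|good U2|%:R).
  apply: le_trans (ler_sum _ (fun u _ => IH U2 u ltU)) _.
  rewrite sumr_const -[_ *+ _]mulr_natl ler_wpM2r ?mulr_ge0 // ler_nat.
  apply: leq_trans (deg e); apply/subset_leq_card/subsetP => u.
  by rewrite !inE negb_and => /andP[/orP[/negP|]].
have := ler_wpM2r (ler0n R #|good U2|) pd.
lra.
Qed.

(** Each further event removes at most a fraction [2 * p <= 1 / 2] of the outcomes that are still
    good. *)
Lemma local_lemma : exists f : Omega, forall e, f \notin B e.
Proof.
suff: forall n (U : {set E}), (#|U| <= n)%N -> (0 < #|good U|)%N.
  move=> /(_ _ setT (leqnn _))/card_gt0P[f]; rewrite inE => /forall_inP fB.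
  by exists f => e; apply: fB; rewrite inE.
have p2 : 4%:R * p <= 1.
  apply: le_trans pd; rewrite ler_peMr ?mulr_ge0 // ler1n //.
elim=> [|n IH] U.
  rewrite leqn0 cards_eq0 => /eqP->; have /card_gt0P[f _] := card_Omega_gt0.
  by apply/card_gt0P; exists f; rewrite inE; apply/forall_inP => e; rewrite inE.
have [->|[e eU]] := set_0Vmem U; first by move=> _; apply: IH; rewrite cards0.
rewrite (cardsD1 e) eU ltnS => /IH pos.
have : (#|good (U :\ e)| <= #|good U| + #|good (U :\ e) :&: B e|)%N.
  apply: leq_trans (leq_card_setU _ _); apply/subset_leq_card/subsetP => f fU.
  rewrite !inE; have [fe|fe] := boolP (f \in B e).
    by move: fU; rewrite inE => ->; rewrite orbT.
  rewrite andbF orbF; apply/forall_inP => u uU.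
  have [->//|ue] := eqVneq u e.
  by move: fU; rewrite inE => /forall_inP; apply; rewrite !inE ue.
rewrite -(ler_nat R) natrD => le1; have le2 := good_bad (U :\ e) e.
have := ler_wpM2r (ler0n R #|good (U :\ e)|) p2.
move: pos; rewrite -!(ltr_nat R); lra.
Qed.

End LocalLemma.

(** * Random color classes *)

Section RandomClasses.
Variable D : digraph.
Implicit Types (A : {set D}) (v x y z : D).

(* The vertices of [A] that lie on no directed cycle within [A] could also be
   kept, but whether a vertex belongs to such a cycle is not a local property;
   the local lemma needs events that depend on [A] near [v] only. *)
Definition isolated_pair A x y : bool :=
  [&& x \in A, y \in A, ~~ (arc x y && arc y x),
      outn x :&: A \subset [set x; y] & outn y :&: A \subset [set x; y]].

Definition isolated_part A : {set D} := [set x | [exists y, isolated_pair A x y]].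

(** A directed cycle would step from [x] to its partner [y] and from [y] back to [x], but the pair
    is not a digon. *)
Lemma acyclic_isolated_part A : acyclic_in (isolated_part A).
Proof.
move=> [//|x c] _ _ cI; apply/negP => cyc.
have next_in z : z \in x :: c -> next (x :: c) z \in A.
  move=> zc; have := cI (next (x :: c) z).
  by rewrite mem_next zc => /(_ isT); rewrite inE => /existsP[y /and5P[]].
have xc : x \in x :: c by rewrite mem_head.
have := cI x xc; rewrite inE => /existsP[y /and5P[_ _ dig /subsetP xA /subsetP yA]].
have a1 := next_cycle cyc xc.
have := xA (next (x :: c) x); rewrite !inE a1 next_in // => /(_ isT)/orP[]/eqP E.
  by rewrite E arc_irr in a1.
have yc : y \in x :: c by rewrite -E mem_next.
have a2 := next_cycle cyc yc.
have := yA (next (x :: c) y); rewrite !inE a2 next_in // => /(_ isT)/orP[]/eqP E2.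
  by move: dig; rewrite -{2}E2 a2 -E a1.
by rewrite E2 arc_irr in a2.
Qed.

(** If [isolated_part A] gets a single color, that color then occurs twice among the out-neighbours
    of [v], which saves one color at [v]. *)
Definition reused A v : bool :=
  [exists x in outn v, exists y in outn v, (x != y) && isolated_pair A x y].

Lemma isolated_pairC A x y : isolated_pair A x y = isolated_pair A y x.
Proof.
rewrite /isolated_pair [arc x y && _]andbC (setUC [set x]).
by rewrite andbCA; do !bool_congr.
Qed.

(** Each class seen from [v] contributes one out-neighbour to the double count, and each reused
    class a second one. The count exceeds the number of colored out-neighbours by at most the
    surplus, the memberships beyond the first. The rest is greedy. *)
Lemma dicolorable_from_classes m k (A : 'I_m -> {set D}) :
    m <= k ->
    (forall v, #|outn v| + \sum_(x in outn v) #|[set c | x \in A c]|.-1 <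
               k + #|[set c | reused (A c) v]|) ->
  dicolorable D k.
Proof.
(* For [k = 0] no default color exists; but then [m = 0], and the hypothesis excludes any vertex. *)
move=> mk few; have [k0|k_gt0] := posnP k.
  have noD : D -> False.
    move=> v; have := few v; rewrite k0 add0n.
    have := max_card (mem [set c | reused (A c) v]); rewrite card_ord.
    by move=> /leq_trans/(_ mk); rewrite k0 leqn0 => /eqP->.
  by apply/dicolorableP; exists (fun v => False_rect _ (noD v)) => -[i]; rewrite k0.
pose I c := isolated_part (A c).
pose S := \bigcup_c I c.
pose f x : 'I_k := if [pick c | x \in I c] is Some c then widen_ord mk c
                   else Ordinal k_gt0.
have fI x : x \in S -> exists2 c, x \in I c & f x = widen_ord mk c.
  case/bigcupP => c _ xc; rewrite /f; case: pickP => [c' xc'|/(_ c)].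
    by exists c'.
  by rewrite xc.
apply: (@greedy_dicoloring D k S f) => [i|v _].
  have [im|im] := ltnP i m; last first.
    apply: (acyclic_inS _ (@acyclic_in0 D)); apply/subsetP => x; rewrite inE.
    case/andP => /fI[c _ ->] /eqP E; move: im.
    by rewrite -E /= leqNgt ltn_ord.
  apply: acyclic_inS (@acyclic_isolated_part (A (Ordinal im))).
  apply/subsetP => x; rewrite inE => /andP[/fI[c xc ->] /eqP E].
  by rewrite (_ : Ordinal im = c) //; apply: val_inj; rewrite /= -E.
have le_colors : #|f @: (outn v :&: S)| <= #|[set c | [exists x in outn v, x \in I c]]|.
  have inj : injective (widen_ord mk).
    by move=> c c' /(congr1 val) cc'; apply: val_inj.
  rewrite -(card_imset _ inj).
  apply/subset_leq_card/subsetP => _ /imsetP[x /setIP[vx xS] ->].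
  have [c xc ->] := fI x xS; apply: imset_f; rewrite inE.
  by apply/existsP; exists x; rewrite vx.
have count : #|[set c | [exists x in outn v, x \in I c]]| + #|[set c | reused (A c) v]|
    <= \sum_(c < m) #|[set x in outn v | x \in I c]|.
  rewrite -2!sum1_card big_mkcond [X in _ + X <= _]big_mkcond -big_split /=; apply: leq_sum => c _.
  rewrite !inE; have [reu|_] := boolP (reused _ _).
    have /exists_inP[x vx /exists_inP[y vy /andP[xy iso]]] := reu.
    apply: leq_trans (_ : 2 <= _); first by case: ifP.
    have <- : #|[set x; y]| = 2 by rewrite cards2 xy.
    apply/subset_leq_card/subsetP => z; rewrite !inE => /orP[]/eqP->.
      by rewrite inE in vx; rewrite vx; apply/existsP; exists y.
    rewrite inE in vy; rewrite vy; apply/existsP; exists x.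
    by rewrite isolated_pairC.
  rewrite addn0; case: ifP => // /exists_inP[x vx xI].
  by apply/card_gt0P; exists x; rewrite inE vx.
have exch : \sum_(c < m) #|[set x in outn v | x \in I c]|
    <= \sum_(x in outn v :&: S) (1 + #|[set c | x \in A c]|.-1).
  under [X in X <= _]eq_bigr do rewrite -sum1_card big_mkcond /=.
  rewrite exchange_big [X in _ <= X]big_mkcond; apply: leq_sum => x _.
  rewrite -big_mkcond /= sum1_card in_setI.
  rewrite (eq_card (B := [set c | (x \in outn v) && (x \in I c)])); last first.
    by move=> c; rewrite [RHS]in_set; exact: in_set.
  have [vx|nvx] := boolP (x \in outn v); last first.
    by rewrite eq_card0 // => c; rewrite in_set.
  have [xS|xS] := boolP (x \in S); last first.
    rewrite eq_card0 // => c; apply/negP => /setIdP[_ xI].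
    by case/negP: xS; apply/bigcupP; exists c.
  apply: leq_trans (_ : #|[set c | x \in A c]| <= _); last by rewrite add1n leqSpred.
  apply/subset_leq_card/subsetP => c /setIdP[_].
  by rewrite !inE => /existsP[y /and5P[]].
rewrite big_split /= sum1_card in exch.
have subL : \sum_(x in outn v :&: S) #|[set c | x \in A c]|.-1 <=
            \sum_(x in outn v) #|[set c | x \in A c]|.-1.
  rewrite [X in _ <= X](bigID (mem S)) /=.
  rewrite (eq_bigl (fun x => (x \in outn v) && (x \in S))) ?leq_addr //.
  by move=> x; rewrite inE.
have cID := cardsID S (outn v).
apply: leq_ltn_trans (leq_add le_colors (leqnn _)) _.
rewrite -(ltn_add2r #|[set c | reused (A c) v]|); apply: leq_ltn_trans (few v).
rewrite -cID addnAC.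
apply: leq_trans (leq_add (leq_trans count exch) (leqnn _)) _.
by rewrite addnAC leq_add2l.
Qed.
End RandomClasses.

(** * Exponential moments and elementary inequalities *)

Section Estimates.
Variable R : realFieldType.
Local Open Scope ring_scope.

Lemma sum_ffun_prod (I J : finType) (F : I -> J -> R) :
  \sum_(f : {ffun I -> J}) \prod_i F i (f i) = \prod_i \sum_j F i j.
Proof. by rewrite bigA_distr_bigA. Qed.

Lemma card_ffun_forall (I J : finType) (P : I -> pred J) :
  #|[set f : {ffun I -> J} | [forall i, P i (f i)]]|%:R =
  \prod_i #|[set j | P i j]|%:R :> R.
Proof.
transitivity (\prod_i \sum_j (P i j)%:R : R); last first.
  apply: eq_bigr => i _; rewrite -sum1_card natr_sum [RHS]big_mkcond /=.
  by apply: eq_bigr => j _; rewrite inE; case: (P i j).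
rewrite -sum_ffun_prod -sum1_card natr_sum [LHS]big_mkcond /=.
apply: eq_bigr => f _; rewrite inE.
case: ifP => [/forallP Pf|/negbT].
  by rewrite big1 // => i _; rewrite Pf.
by rewrite negb_forall => /existsP[i /negPf Pi]; rewrite (bigD1 i) //= Pi mul0r.
Qed.

Lemma markov_exp2 (T : finType) (X : T -> nat) n (a : R) : 1 <= a ->
  #|[set w | (n <= X w)%N]|%:R * a ^+ n <= \sum_w a ^+ X w.
Proof.
move=> a1; rewrite -sum1_card natr_sum mulr_suml big_mkcond /=.
apply: ler_sum => w _; rewrite inE.
case: ifP => [le|_]; last by rewrite exprn_ge0 // (le_trans ler01).
by rewrite mul1r ler_weXn2l.
Qed.

Lemma markov_expV2 (T : finType) (X : T -> nat) n :
  #|[set w | (X w < n)%N]|%:R <= 2%:R ^+ n * \sum_w (2%:R^-1 : R) ^+ X w.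
Proof.
rewrite -sum1_card natr_sum mulr_sumr big_mkcond /=.
apply: ler_sum => w _; rewrite inE.
have p2 : (0 : R) < 2 by rewrite ltr0n.
case: ifP => [lt|_]; last by rewrite mulr_ge0 ?exprn_ge0 ?invr_ge0 // ltW.
by rewrite exprVn ler_pdivlMr ?exprn_gt0 // mul1r ler_weXn2l ?ler1n // ltnW.
Qed.

(** Its linear term cancels against that of [expr_oneMx_le] in [sum_exp2_surplus], which leaves a
    quadratic error. *)
Lemma expr_onePx_le (x : R) n : 0 <= x -> n%:R * x <= 1 ->
  (1 + x) ^+ n <= 1 + n%:R * x + (n%:R * x) ^+ 2.
Proof.
move=> x0; elim: n => [|n IH] le1; first by rewrite expr0 mul0r expr0n /= !addr0.
rewrite -natr1 in le1 *.
have n0 := ler0n R n; have nx0 := mulr_ge0 n0 x0.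
have le1' : n%:R * x <= 1 by nra.
have H := IH le1'; rewrite exprS.
have := ler_wpM2l (_ : 0 <= 1 + x) H; rewrite addr_ge0 // => /(_ isT) H'.
apply: le_trans H' _; rewrite !expr2; set a := n%:R * x in nx0 le1' *.
have -> : (n%:R + 1) * x = a + x by rewrite /a; ring.
have : a * a * x <= a * x by rewrite -mulrA ler_piMl // mulr_ge0.
have := mulr_ge0 x0 x0; lra.
Qed.

Lemma expr_oneMx_le (x : R) n : 0 <= x -> x <= 1 ->
  (1 - x) ^+ n <= 1 - n%:R * x + (n%:R * x) ^+ 2.
Proof.
move=> x0 x1; elim: n => [|n IH]; first by rewrite expr0 mul0r expr0n /= subr0 addr0.
rewrite -natr1; have n0 := ler0n R n; have nx0 := mulr_ge0 n0 x0.
rewrite exprS; have := ler_wpM2l (_ : 0 <= 1 - x) IH; rewrite subr_ge0 x1 => /(_ isT) H'.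
apply: le_trans H' _; rewrite !expr2; set a := n%:R * x in nx0 *.
have -> : (n%:R + 1) * x = a + x by rewrite /a; ring.
have := mulr_ge0 (mulr_ge0 nx0 nx0) x0; have := mulr_ge0 x0 x0.
have := mulr_ge0 nx0 x0; lra.
Qed.

Lemma bernoulli_oneMx (x : R) n : 0 <= x -> x <= 1 -> 1 - n%:R * x <= (1 - x) ^+ n.
Proof.
move=> x0 x1; elim: n => [|n IH]; first by rewrite expr0 mul0r subr0.
rewrite -natr1 exprS; have := ler_wpM2l (_ : 0 <= 1 - x) IH.
rewrite subr_ge0 x1 => /(_ isT) H'; apply: le_trans H'.
have := mulr_ge0 (mulr_ge0 (ler0n R n) x0) x0; lra.
Qed.

(* [2 * 2 ^ j.-1 = 2 ^ j + (j == 0)], where [0.-1 = 0]. *)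
Lemma sum_exp2_surplus m q (x : R) : x = q.+1%:R^-1 -> m%:R * x <= 1 ->
  \sum_(f : {ffun 'I_m -> 'I_q.+1}) 2%:R ^+ #|[set c | f c == ord0]|.-1
    <= q.+1%:R ^+ m * (1 + (m%:R * x) ^+ 2).
Proof.
move=> xE mx.
have Q0 : (0 : R) < q.+1%:R by rewrite ltr0n.
have x0 : 0 <= x by rewrite xE invr_ge0 ltW.
have x1 : x <= 1 by rewrite xE invf_le1 // ler1n.
have Qx : q.+1%:R * x = 1 by rewrite xE divff // gt_eqF.
have prodP (f : {ffun 'I_m -> 'I_q.+1}) (a b : R) :
    \prod_c (if f c == ord0 then a else b) =
    a ^+ #|[set c | f c == ord0]| * b ^+ #|[set c | f c != ord0]|.
  rewrite (bigID (fun c => f c == ord0)) /=; congr (_ * _).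
    rewrite (eq_bigr (fun=> a)); last by move=> c ->.
    by rewrite prodr_const; congr (_ ^+ _); apply: eq_card => c; rewrite inE.
  rewrite (eq_bigr (fun=> b)); last by move=> c /negPf->.
  by rewrite prodr_const; congr (_ ^+ _); apply: eq_card => c; rewrite inE.
have sumP (a b : R) :
    \sum_(f : {ffun 'I_m -> 'I_q.+1}) \prod_c (if f c == ord0 then a else b) =
    (a + q%:R * b) ^+ m.
  rewrite (sum_ffun_prod (fun _ j => if j == ord0 then a else b)).
  rewrite prodr_const card_ord; congr (_ ^+ _).
  by rewrite big_ord_recl eqxx /= sumr_const card_ord mulr_natl.
(* With [b = 1], the product of [prodP] is [2 ^ j] for [a = 2] and the indicator of [j = 0] for
   [a = 0]. *)
have -> : \sum_(f : {ffun 'I_m -> 'I_q.+1}) 2%:R ^+ #|[set c | f c == ord0]|.-1 =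
    2%:R^-1 * ((2%:R + q%:R * 1) ^+ m + (0 + q%:R * 1) ^+ m) :> R.
  rewrite -!sumP -big_split /= mulr_sumr; apply: eq_bigr => f _.
  rewrite !prodP !expr1n !mulr1; case: #|_| => [|j].
    by rewrite expr0; lra.
  by rewrite expr0n /= addr0 exprS mulrA mulVf ?mul1r // pnatr_eq0.
have -> : 2%:R + q%:R * 1 = q.+1%:R * (1 + x) by rewrite mulrDr Qx -[q.+1%:R]natr1; lra.
have -> : 0 + q%:R * 1 = q.+1%:R * (1 - x) by rewrite mulrBr Qx -[q.+1%:R]natr1; lra.
rewrite !(exprMn m) -mulrDr mulrCA ler_wpM2l ?exprn_ge0 //.
have := expr_onePx_le x0 mx; have := expr_oneMx_le m x0 x1; lra.
Qed.

(** Vertices choose independently, so the exponential moment of the surplus is a product over [N] of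
    factors bounded by [sum_exp2_surplus]. *)
Lemma surplus_tail (V : finType) (N : {set V}) m q (x : R) n :
    x = q.+1%:R^-1 -> m%:R * x <= 1 ->
  #|[set w : {ffun V -> {ffun 'I_m -> 'I_q.+1}} |
      (n <= \sum_(v in N) #|[set c | w v c == ord0]|.-1)%N]|%:R * 2%:R ^+ n <=
  #|{ffun V -> {ffun 'I_m -> 'I_q.+1}}|%:R * (1 + (m%:R * x) ^+ 2) ^+ #|N|.
Proof.
move=> xE mx; pose T := {ffun 'I_m -> 'I_q.+1}.
have cT : #|T|%:R = q.+1%:R ^+ m :> R by rewrite card_ffun !card_ord natrX.
apply: le_trans (markov_exp2 _ _ _) _; first by rewrite ler1n.
pose h v (f : T) : R := if v \in N then 2%:R ^+ #|[set c | f c == ord0]|.-1 else 1.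
rewrite (eq_bigr (fun w : {ffun V -> T} => \prod_v h v (w v))); last first.
  by move=> w _; rewrite -prodrXr big_mkcond.
rewrite sum_ffun_prod card_ffun natrX.
have -> : (#|T|%:R : R) ^+ #|V| * (1 + (m%:R * x) ^+ 2) ^+ #|N| =
          \prod_v (#|T|%:R * (if v \in N then 1 + (m%:R * x) ^+ 2 else 1)).
  by rewrite big_split /= prodr_const -big_mkcond /= prodr_const.
apply: ler_prod => v _; rewrite /h; case: (v \in N).
  rewrite sumr_ge0 => [|f _]; last by rewrite exprn_ge0.
  by rewrite cT; exact: sum_exp2_surplus.
by rewrite sumr_ge0 // sumr_const mulr1 lexx.
Qed.
End Estimates.

(** * Probability that a random sparse set is reused *)

Section ReuseProbability.
Variables (R : realFieldType) (D : digraph).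
Local Open Scope ring_scope.
Implicit Types (v x y z : D).

(** For uniform [a], a random set that keeps each vertex independently with probability
    [1 / q.+1]. *)
Definition zeros q (a : {ffun D -> 'I_q.+1}) : {set D} := [set x | a x == ord0].

(** Excluding the other vertices of [outn x] and [outn y] isolates the pair; excluding those of
    [outn v] makes the events of different pairs nearly disjoint. *)
Definition exact_pair q v x y : {set {ffun D -> 'I_q.+1}} :=
  [set a : {ffun D -> 'I_q.+1} | [forall z, if z \in [set x; y] then a z == ord0
      else (z \in outn v :|: outn x :|: outn y) ==> (a z != ord0)]].

Lemma exact_pair_reused q v x y (a : {ffun D -> 'I_q.+1}) :
  (x, y) \in nondigon_pairs v -> a \in exact_pair q v x y -> reused (zeros a) v.
Proof.
rewrite !inE /= => /and3P[vx vy /andP[xy nxy]] /forallP aP.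
have az z : z \in [set x; y] -> a z = ord0 by move=> zP; have := aP z; rewrite zP => /eqP.
have sub u : u \in [set x; y] -> outn u :&: zeros a \subset [set x; y].
  move=> uP; apply/subsetP => z; rewrite in_setI => /andP[uz]; rewrite inE => a0.
  have := aP z; case: ifP => // _; rewrite a0 implybF !in_setU => /negP[].
  by move: uP; rewrite !inE in uz * => /orP[]/eqP<-; rewrite uz ?orbT.
apply/exists_inP; exists x; first by rewrite inE.
apply/exists_inP; exists y; first by rewrite inE.
by rewrite xy /isolated_pair !inE !az ?inE ?eqxx ?orbT //= nxy !sub ?inE ?eqxx ?orbT.
Qed.

(** The pair consists of the only zeros of [a] in [outn v]; just its two orders remain. *)
Lemma exact_pair_le2 q v (a : {ffun D -> 'I_q.+1}) :
  (#|[set p in nondigon_pairs v | a \in exact_pair q v p.1 p.2]| <= 2)%N.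
Proof.
have [->|[[x y]]] := set_0Vmem [set p in nondigon_pairs v | a \in exact_pair q v p.1 p.2].
  by rewrite cards0.
case/setIdP=> /=; rewrite in_set /= => /and3P[vx vy /andP[xy _]].
rewrite inE => /forallP aP.
apply: (@leq_trans #|[set (x, y); (y, x)]|); last first.
  by rewrite cards2; case: (_ != _).
apply/subset_leq_card/subsetP => -[x' y'] /setIdP[]; rewrite in_set /=.
move=> /and3P[vx' vy' /andP[xy' _]]; rewrite in_set => /forallP aP'.
have zP z : z \in outn v -> z \in [set x'; y'] -> z \in [set x; y].
  move=> vz z'; have := aP' z; rewrite z' => a0; have := aP z.
  by case: ifP => // _; rewrite a0 !in_setU vz.
have := zP x' vx'; have := zP y' vy'; rewrite !inE !eqxx orbT /=.
move=> /(_ isT)/orP[]/eqP Ey /(_ isT)/orP[]/eqP Ex; move: xy'; rewrite Ex Ey.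
all: by rewrite ?eqxx //= ?orbT // !xpair_eqE !eqxx ?orbT.
Qed.

(** Both vertices are zeros with probability [r ^ 2]. By Bernoulli's inequality, the at most [6 * k]
    vertices to exclude cost a factor at least [1 - 6 * k * r >= 1 / 2]. *)
Lemma card_exact_pair q v x y (r : R) k : r = q.+1%:R^-1 -> x != y ->
    {in [set v; x; y], forall u, #|outn u| <= 2 * k}%N -> (12 * k <= q.+1)%N ->
  #|{ffun D -> 'I_q.+1}|%:R * (r ^+ 2 / 2%:R) <= #|exact_pair q v x y|%:R.
Proof.
move=> rE xy deg kq.
have Q0 : (0 : R) < q.+1%:R by rewrite ltr0n.
have r0 : 0 <= r by rewrite rE invr_ge0 ltW.
have r1 : r <= 1 by rewrite rE invf_le1 // ler1n.
have Qr : q.+1%:R * r = 1 by rewrite rE divff // gt_eqF.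
pose Z := outn v :|: outn x :|: outn y.
have cZ : (#|Z| <= 6 * k)%N.
  have := leq_card_setU (outn v :|: outn x) (outn y).
  have := leq_card_setU (outn v) (outn x).
  have := deg v; have := deg x; have := deg y; rewrite !inE !eqxx ?orbT /=.
  move=> /(_ isT) dy /(_ isT) dx /(_ isT) dv [le1 _] [le2 _].
  apply: leq_trans le2 _; lia.
rewrite /exact_pair.
rewrite (card_ffun_forall R (fun z j => if z \in [set x; y] then j == ord0
  else (z \in outn v :|: outn x :|: outn y) ==> (j != ord0))).
apply: (@le_trans _ _ (\prod_z (q.+1%:R * ((if z \in [set x; y] then r else 1) *
                                (if z \in Z then 1 - r else 1))))).
  rewrite big_split /= prodr_const card_ffun card_ord natrX.
  rewrite ler_wpM2l ?exprn_ge0 // big_split /= -!big_mkcond /= !prodr_const.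
  rewrite cards2 xy; apply: ler_wpM2l; first by rewrite exprn_ge0.
  apply: le_trans (bernoulli_oneMx _ r0 r1).
  have : #|Z|%:R * r <= 2%:R^-1; last by lra.
  have : (2 * #|Z| <= q.+1)%N by apply: leq_trans kq; lia.
  rewrite -(ler_nat R) natrM => le.
  have := ler_wpM2r r0 le; rewrite Qr; lra.
apply: ler_prod => z _.
have b0 : 0 <= 1 - r by rewrite subr_ge0.
rewrite mulr_ge0 ?mulr_ge0 //=; [|by case: ifP|by case: ifP].
have [zxy|zxy] := boolP (z \in [set x; y]).
  rewrite (_ : [set j | _] = [set ord0]); last by apply/setP => j; rewrite !inE.
  rewrite cards1 mulrA Qr mul1r; case: ifP => // _; lra.
rewrite -/Z; have [zZ|zZ] := boolP (z \in Z).
  rewrite (_ : [set j | _] = [set~ ord0]); last by apply/setP => j; rewrite !inE.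
  by rewrite cardsC1 card_ord /= mul1r mulrBr mulr1 Qr -natr1 addrK.
rewrite (_ : [set j | _] = setT); last by apply/setP => j; rewrite !inE.
by rewrite cardsT card_ord !mulr1.
Qed.

(** The events [exact_pair] imply [reused] and cover each outcome at most twice, so their
    probabilities add up to at most twice that of [reused]. *)
Lemma card_reused q v (r : R) k t : r = q.+1%:R^-1 ->
    (forall u : D, #|outn u| <= 2 * k)%N -> (12 * k <= q.+1)%N ->
    (t <= #|nondigon_pairs v|)%N ->
  #|{ffun D -> 'I_q.+1}|%:R * (t%:R * r ^+ 2 / 4%:R) <=
  #|[set a : {ffun D -> 'I_q.+1} | reused (zeros a) v]|%:R.
Proof.
move=> rE deg kq tP.
have r0 : 0 <= r by rewrite rE invr_ge0.
set G := [set a | _].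
have : (\sum_(p in nondigon_pairs v) #|exact_pair q v p.1 p.2| <= #|G| * 2)%N.
  rewrite -card_pair_set -sum_nat_const.
  apply: (@leq_trans (\sum_(a in G)
      #|[set p in nondigon_pairs v | a \in exact_pair q v p.1 p.2]|)%N).
    rewrite -card_pair_set.
    have inj : injective (fun p : D * D * {ffun D -> 'I_q.+1} => (p.2, p.1)).
      by move=> [p a] [p' a'] [-> ->].
    rewrite -(card_imset _ inj); apply/subset_leq_card/subsetP.
    move=> _ /imsetP[[p a] + ->]; rewrite in_set /= => /andP[pP aP].
    rewrite in_set /= [a \in G]in_set; apply/andP; split; last by apply/setIdP.
    by case: p pP aP => x y pP aP; exact: exact_pair_reused pP aP.
  by apply: leq_sum => a _; exact: exact_pair_le2.
rewrite -(ler_nat R) natrM natr_sum => le1.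
have : \sum_(p in nondigon_pairs v) #|{ffun D -> 'I_q.+1}|%:R * (r ^+ 2 / 2%:R) <=
       \sum_(p in nondigon_pairs v) #|exact_pair q v p.1 p.2|%:R.
  apply: ler_sum => -[x y]; rewrite in_set => /and3P[/= _ _ /andP[xy _]].
  by apply: (card_exact_pair rE xy _ kq) => u _; apply: deg.
rewrite sumr_const -[_ *+ _]mulr_natl => le2.
have le3 : t%:R * (#|{ffun D -> 'I_q.+1}|%:R * (r ^+ 2 / 2%:R)) <=
  #|nondigon_pairs v|%:R * (#|{ffun D -> 'I_q.+1}|%:R * (r ^+ 2 / 2%:R)).
  by rewrite ler_wpM2r ?ler_nat // mulr_ge0 // mulr_ge0 ?exprn_ge0 ?invr_ge0.
have {le1 le2 le3} := le_trans le3 (le_trans le2 le1).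
set w := #|{ffun D -> 'I_q.+1}|%:R; set b := #|G|%:R; set s := r ^+ 2; lra.
Qed.

(** The classes are independent, and each multiplies the expectation of [2 ^ (- count)] by at most
    [1 - rho / 2]. *)
Lemma reuse_tail q m v (rho : R) n :
    0 <= rho -> rho <= 1 ->
    #|{ffun D -> 'I_q.+1}|%:R * rho <=
      #|[set a : {ffun D -> 'I_q.+1} | reused (zeros a) v]|%:R ->
  #|[set w : {ffun D -> {ffun 'I_m -> 'I_q.+1}} |
      (#|[set c | reused [set x | w x c == ord0] v]| < n)%N]|%:R <=
  #|{ffun D -> {ffun 'I_m -> 'I_q.+1}}|%:R * (2%:R ^+ n * (1 - rho / 2%:R) ^+ m).
Proof.
move=> rho0 rho1 le; set half := 2%:R^-1 : R.
apply: le_trans (markov_expV2 R _ _) _; rewrite mulrCA ler_wpM2l ?exprn_ge0 //.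
(* Transposing indexes outcomes by class first, so that the moment factors over classes. *)
pose flip (w : {ffun 'I_m -> {ffun D -> 'I_q.+1}}) : {ffun D -> {ffun 'I_m -> 'I_q.+1}} :=
  [ffun x => [ffun c => w c x]].
pose flip' (w : {ffun D -> {ffun 'I_m -> 'I_q.+1}}) : {ffun 'I_m -> {ffun D -> 'I_q.+1}} :=
  [ffun c => [ffun x => w x c]].
have flipK : cancel flip flip' by move=> w; apply/ffunP => c; apply/ffunP => x; rewrite !ffunE.
have flipK' : cancel flip' flip by move=> w; apply/ffunP => c; apply/ffunP => x; rewrite !ffunE.
rewrite (reindex flip) /=; last by exists flip' => w _; [apply: flipK|apply: flipK'].
pose h (a : {ffun D -> 'I_q.+1}) : R := if reused (zeros a) v then half else 1.
rewrite (eq_bigr (fun w : {ffun 'I_m -> {ffun D -> 'I_q.+1}} => \prod_c h (w c))); last first.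
  move=> w _; rewrite /h -big_mkcond prodr_const /=; congr (_ ^+ _).
  apply: eq_card => c; rewrite inE; congr (reused _ v); apply/setP => x.
  by rewrite !inE !ffunE.
rewrite (sum_ffun_prod (fun _ => h)) prodr_const card_ord.
have -> : #|{ffun D -> {ffun 'I_m -> 'I_q.+1}}|%:R = #|{ffun D -> 'I_q.+1}|%:R ^+ m :> R.
  by rewrite !card_ffun !card_ord !natrX -!exprM mulnC.
rewrite -exprMn; apply: lerXn2r; rewrite ?nnegrE.
- by rewrite sumr_ge0 // => a _; rewrite /h; case: ifP; rewrite ?invr_ge0.
- by rewrite mulr_ge0 // /half; lra.
have -> : \sum_(a : {ffun D -> 'I_q.+1}) h a = #|{ffun D -> 'I_q.+1}|%:R -
   half * #|[set a : {ffun D -> 'I_q.+1} | reused (zeros a) v]|%:R.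
  rewrite -[in RHS]sum1_card -cardsT -sum1_card !natr_sum mulr_sumr.
  rewrite [X in _ - X]big_mkcond [X in X - _]big_mkcond -sumrB; apply: eq_bigr => a _.
  rewrite /h !inE; case: ifP => _; rewrite /half; lra.
rewrite /half; lra.
Qed.
End ReuseProbability.

(** A step multiplies [(j + 5) ^ 5] by at most [(6 / 5) ^ 5 < 4]; the extra fifth factor absorbs
    [C]. *)
Lemma exp4_dominates (C : nat) : exists j0, forall j, j0 <= j -> C * j.+1 ^ 4 <= 4 ^ j.
Proof.
have pow5 j : (j + 5) ^ 5 <= 5 ^ 5 * 4 ^ j.
  elim: j => [|j IH]; first by rewrite add0n muln1.
  have : (5 * (j.+1 + 5)) ^ 5 <= (6 * (j + 5)) ^ 5 by rewrite leq_exp2r //; lia.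
  rewrite !expnMn => le; rewrite -(leq_pmul2l (_ : 0 < 5 ^ 5)) //.
  apply: leq_trans le _; apply: leq_trans (leq_mul (leqnn _) IH) _.
  rewrite (expnS 4) [X in _ <= X](_ : _ = 4 * 5 ^ 5 * (5 ^ 5 * 4 ^ j)).
    by rewrite leq_mul2r; apply/orP; right.
  by move: (5 ^ 5) (4 ^ j) => a b; ring.
exists (C * 5 ^ 5) => j le; rewrite -(leq_pmul2l (_ : 0 < 5 ^ 5)) //.
apply: leq_trans (pow5 j); apply: leq_trans (_ : j.+1 ^ 5 <= _).
  rewrite mulnA [X in _ <= X]expnS leq_mul2r mulnC; apply/orP; right.
  exact: leq_trans le _.
by rewrite leq_exp2r // -addn1 leq_add2l.
Qed.

Lemma reused_local (D : digraph) (A B : {set D}) v :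
    {in outn v :|: \bigcup_(x in outn v) outn x, A =i B} ->
  reused A v = reused B v.
Proof.
move=> AB; have step x y : x \in outn v -> y \in outn v ->
    isolated_pair A x y = isolated_pair B x y.
  have AB1 u : u \in outn v -> (u \in A) = (u \in B).
    by move=> vu; apply: AB; rewrite in_setU vu.
  have AB2 u : u \in outn v -> outn u :&: A = outn u :&: B.
    move=> vu; apply/setP => z; rewrite !in_setI; case uz: (z \in outn u) => //=.
    by apply: AB; rewrite in_setU; apply/orP; right; apply/bigcupP; exists u.
  by move=> vx vy; rewrite /isolated_pair !AB1 // !AB2.
apply: eq_existsb => x; case vx: (x \in outn v) => //=; apply: eq_existsb => y.
by case vy: (y \in outn v) => //=; rewrite step.
Qed.

Lemma card_two_steps (D : digraph) (N : D -> {set D}) n v :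
    (forall u, #|N u| <= n) ->
  #|N v :|: \bigcup_(x in N v) N x| <= n + n ^ 2.
Proof.
move=> Nn; apply: leq_trans (leq_card_setU _ _) (leq_add (Nn v) _).
apply: leq_trans (leq_card_bigcup _ _) _.
apply: leq_trans (leq_sum _ (fun u _ => Nn u)) _.
by rewrite sum_nat_const -mulnn leq_mul2r Nn orbT.
Qed.

(** * Coloring by the local lemma when out-neighbourhoods are sparse *)

Section SparseColoring.
Variables (R : realFieldType) (D : digraph) (k j t r : nat).
(** A vertex lies in [m / (12 * k) <= 1 / (6 * r)] of the [m] classes on average, whereas a class is
    reused at [v] with probability at least [1 / r]. The expected surplus at [v] is at most
    [2 * (j + 1)], the expected number of reused classes at least [72 * j]. *)
Local Notation M := (36 * r ^ 2).
Local Notation m := (72 * r * j).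
Hypotheses (r2 : 2 <= r) (j_gt0 : 0 < j).
Hypotheses (Mj_le_k : M * j <= k) (k_lt : k < M * j.+1).
Hypothesis j_large : 288 * (M * j.+1) ^ 4 <= 4 ^ j.
Hypothesis rt : 576 * k ^ 2 <= r * t.
Hypothesis outdeg_le : forall v : D, #|outn v| <= k + j.
Hypothesis indeg_le : forall v : D, #|inn v| <= k + j.
Hypothesis sparse : forall v : D, t <= #|nondigon_pairs v|.
Local Open Scope ring_scope.
Let q := (12 * k).-1.
Local Notation Omega := {ffun D -> {ffun 'I_m -> 'I_q.+1}}.
Implicit Types v : D.

Let bad_surplus v : {set Omega} :=
  [set w : Omega | (6 * j + 4 <= \sum_(x in outn v) #|[set c | w x c == ord0]|.-1)%N].

Let bad_reuse v : {set Omega} :=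
  [set w : Omega | (#|[set c | reused [set x | w x c == ord0] v]| < 8 * j + 10)%N].

Let r_gt0 : (0 < r)%N. Proof. exact: leq_trans r2. Qed.

Let M_gt0 : (0 < M)%N. Proof. by rewrite muln_gt0 expn_gt0 r_gt0. Qed.

Let j_le_k : (j <= k)%N. Proof. by apply: leq_trans Mj_le_k; rewrite leq_pmull. Qed.

Let k_gt0 : (0 < k)%N. Proof. exact: leq_trans j_le_k. Qed.

Let qE : q.+1 = (12 * k)%N. Proof. by rewrite prednK // muln_gt0. Qed.

(** By Bernoulli's inequality [(1 - x) ^ n >= 1 / 2], while [(1 + x) ^ n * (1 - x) ^ n <= 1]. *)
Let inv_expr_le (x : R) n : 0 <= x -> x <= 1 -> n%:R * x = 2^-1 ->
  (1 + x) ^+ n <= 2%:R.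
Proof.
move=> x0 x1 nx; have := bernoulli_oneMx n x0 x1; rewrite nx => le.
have le2 : (1 + x) ^+ n * (1 - x) ^+ n <= 1.
  rewrite -exprMn exprn_ile1 //.
    by rewrite mulr_ge0 ?subr_ge0 // addr_ge0.
  by have := mulr_ge0 x0 x0; lra.
have := ler_wpM2l (exprn_ge0 n (addr_ge0 ler01 x0)) le; lra.
Qed.

(** The exponential moment is at most [2 ^ (4 * (j + 1))]; the threshold
    [6 * j + 4 = 2 * j + 4 * (j + 1)] leaves [2 ^ (- 2 * j)]. *)
Let bad_surplus_prob v : #|bad_surplus v|%:R <= (4%:R^-1) ^+ j * #|Omega|%:R :> R.
Proof.
have Q0 : (0 : R) < q.+1%:R by rewrite ltr0n.
have h0 : (0 : R) < (6 * r)%:R by rewrite ltr0n muln_gt0.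
have mx : m%:R * q.+1%:R^-1 <= (6 * r)%:R^-1 :> R.
  rewrite ler_pdivrMr // mulrC ler_pdivlMr // -natrM ler_nat qE.
  by rewrite (_ : 72 * r * j * (6 * r) = 12 * (M * j))%N ?leq_mul2l //; ring.
have mx0 : 0 <= m%:R * q.+1%:R^-1 :> R by rewrite mulr_ge0 ?invr_ge0.
have h1 : (6 * r)%:R^-1 <= 1 :> R by rewrite invf_le1 // ler1n muln_gt0.
have := @surplus_tail R D (outn v) m q _ (6 * j + 4) erefl (le_trans mx h1).
set y : R := (6 * r)%:R^-1 ^+ 2.
have y0 : 0 <= y by rewrite exprn_ge0 ?invr_ge0 ?(ltW h0).
have y1 : y <= 1 by rewrite exprn_ile1 ?invr_ge0 ?(ltW h0).
have le2y : (1 + y) ^+ (18 * r ^ 2) <= 2%:R.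
  apply: inv_expr_le => //; rewrite /y exprVn -natrX.
  rewrite (_ : (6 * r) ^ 2 = 2 * (18 * r ^ 2))%N; last by ring.
  rewrite [X in _ / X]natrM invfM mulrCA divff ?mulr1 // pnatr_eq0 -lt0n.
  by rewrite muln_gt0 expn_gt0 r_gt0.
have le4 : (1 + (m%:R * q.+1%:R^-1) ^+ 2) ^+ #|outn v| <= 2%:R ^+ (4 * j.+1) :> R.
  apply: (@le_trans _ _ ((1 + y) ^+ #|outn v|)).
    apply: lerXn2r; rewrite ?nnegrE ?addr_ge0 ?exprn_ge0 ?invr_ge0 ?(ltW h0) //.
    by rewrite lerD2l; apply: lerXn2r; rewrite ?nnegrE ?invr_ge0 ?(ltW h0).
  apply: (@le_trans _ _ ((1 + y) ^+ (18 * r ^ 2 * (4 * j.+1)))).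
    apply: ler_weXn2l; first by rewrite lerDl.
    apply: leq_trans (outdeg_le v) _; apply: (@leq_trans (2 * (M * j.+1))).
      by rewrite mul2n -addnn leq_add ?(leq_trans j_le_k) // ltnW.
    by rewrite (_ : 2 * _ = 18 * r ^ 2 * (4 * j.+1))%N //; ring.
  rewrite exprM; apply: lerXn2r => //.
    by rewrite ?nnegrE ?exprn_ge0 ?addr_ge0 ?exprn_ge0 ?invr_ge0 ?(ltW h0).
  by rewrite nnegrE.
move=> le; have O0 : 0 <= #|Omega|%:R :> R by [].
have p2 n : (0 : R) < 2%:R ^+ n by rewrite exprn_gt0.
rewrite -(ler_pM2r (p2 (6 * j + 4)%N)).
apply: le_trans le _; apply: le_trans (ler_wpM2l O0 le4) _.
rewrite mulrAC [X in _ <= X]mulrC ler_wpM2l //.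
have -> : (6 * j + 4 = 2 * j + 4 * j.+1)%N by ring.
have h4 : 4%:R^-1 * 2%:R ^+ 2 = 1 :> R by rewrite expr2; lra.
by rewrite exprD mulrA [2 ^+ (2 * j)]exprM -exprMn h4 expr1n mul1r.
Qed.

(** Every [2 * r] classes contribute a factor at most [1 / 2], hence [2 ^ (- 36 * j)] in all; the
    threshold costs [2 ^ (8 * j + 10) <= 2 ^ (34 * j)]. *)
Let bad_reuse_prob v : #|bad_reuse v|%:R <= (4%:R^-1) ^+ j * #|Omega|%:R :> R.
Proof.
have r0 : (0 : R) < r%:R by rewrite ltr0n.
have rho0 : 0 <= r%:R^-1 :> R by rewrite invr_ge0.
have rho1 : r%:R^-1 <= 1 :> R by rewrite invf_le1 // ler1n.
have Q0 : (0 : R) < q.+1%:R by rewrite ltr0n.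
have le : #|{ffun D -> 'I_q.+1}|%:R * r%:R^-1 <=
      #|[set a : {ffun D -> 'I_q.+1} | reused (zeros a) v]|%:R :> R.
  have leQ : (12 * k <= q.+1)%N by rewrite qE.
  have le2k (u : D) : (#|outn u| <= 2 * k)%N.
    by apply: leq_trans (outdeg_le u) _; rewrite mul2n -addnn leq_add2l.
  apply: le_trans (card_reused erefl le2k leQ (sparse v)).
  apply: ler_wpM2l => //; rewrite exprVn -natrX.
  rewrite ler_pdivlMr ?ltr0n // ler_pdivlMr ?ltr0n ?expn_gt0 //.
  rewrite -mulrA mulrC ler_pdivrMr // -!natrM ler_nat qE mulnC [(t * r)%N]mulnC.
  by apply: leq_trans rt; rewrite (_ : (12 * k) ^ 2 * 4 = 576 * k ^ 2)%N //; ring.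
have half_r : (1 - r%:R^-1 / 2%:R) ^+ (2 * r) <= 2%:R^-1 :> R.
  have x0 : 0 <= r%:R^-1 / 2%:R :> R by rewrite mulr_ge0 ?invr_ge0.
  have x1 : r%:R^-1 / 2%:R <= 1 :> R by lra.
  have le2 : (1 - r%:R^-1 / 2%:R) ^+ (2 * r) * (1 + r%:R^-1 / 2%:R) ^+ (2 * r) <= 1 :> R.
    rewrite -exprMn exprn_ile1 //.
      by rewrite mulr_ge0 ?subr_ge0 // addr_ge0.
    by have := mulr_ge0 x0 x0; lra.
  have ge2 : 2%:R <= (1 + r%:R^-1 / 2%:R) ^+ (2 * r) :> R.
    have bern n : 1 + n%:R * (r%:R^-1 / 2%:R) <= (1 + r%:R^-1 / 2%:R) ^+ n :> R.
      elim: n => [|n IH]; first by rewrite mul0r addr0.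
      rewrite exprS -natr1; have := ler_wpM2l (addr_ge0 ler01 x0) IH.
      apply: le_trans; set x := _ / _ in x0 *.
      have := mulr_ge0 (ler0n R n) (mulr_ge0 x0 x0); lra.
    apply: le_trans (bern _); rewrite natrM.
    have : r%:R * r%:R^-1 = 1 :> R by rewrite divff // gt_eqF.
    set b := r%:R^-1; set a := r%:R; lra.
  have g0 : 0 <= (1 - r%:R^-1 / 2%:R) ^+ (2 * r) :> R by rewrite exprn_ge0 // subr_ge0.
  have := ler_wpM2l g0 ge2; lra.
apply: le_trans (reuse_tail _ _ rho0 rho1 le) _; rewrite mulrC ler_wpM2r //.
have -> : (72 * r * j = 2 * r * (36 * j))%N by ring.
rewrite exprM; apply: (@le_trans _ _ (2%:R ^+ (8 * j + 10) * 2%:R^-1 ^+ (36 * j))).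
  apply: ler_wpM2l; first by rewrite exprn_ge0.
  apply: lerXn2r; rewrite ?nnegrE ?exprn_ge0 ?invr_ge0 // subr_ge0; lra.
apply: (@le_trans _ _ (2%:R ^+ (34 * j) * 2%:R^-1 ^+ (36 * j))).
  rewrite ler_wpM2r ?exprn_ge0 ?invr_ge0 // ler_weXn2l ?ler1n //.
  rewrite (_ : 34 * j = 8 * j + 26 * j)%N; last by ring.
  by rewrite leq_add2l (leq_trans _ (leq_mul (leqnn 26) j_gt0)).
have -> : (36 * j = 34 * j + 2 * j)%N by ring.
rewrite exprD mulrA -exprMn divff ?pnatr_eq0 // expr1n mul1r exprM.
by rewrite exprVn -natrX.
Qed.

Let support v : {set D} := outn v :|: \bigcup_(x in outn v) outn x.

Let depends_bad v : depends_on (support v) (bad_surplus v :|: bad_reuse v).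
Proof.
move=> f g fg; rewrite !in_setU !in_set; congr (_ || _).
  congr (_ <= _)%N; apply: eq_bigr => x vx; congr _.-1; apply: eq_card => c.
  by rewrite !in_set fg // in_setU vx.
congr (_ < _)%N; apply: eq_card => c; rewrite !in_set; apply: reused_local => x xv.
by rewrite !in_set fg.
Qed.

(** Such a [u] is reached from [v] by at most two arcs forwards and then at most two backwards; this
    is where in-degrees must be bounded. *)
Let support_overlap v :
  (#|[set u | ~~ [disjoint support v & support u]]| <= (6 * k ^ 2) ^ 2)%N.
Proof.
have le2k : (forall u : D, #|outn u| <= 2 * k)%N.
  by move=> u; apply: leq_trans (outdeg_le u) _; move: j_le_k; lia.
have le2k' : (forall u : D, #|inn u| <= 2 * k)%N.
  by move=> u; apply: leq_trans (indeg_le u) _; move: j_le_k; lia.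
have le6 : (2 * k + (2 * k) ^ 2 <= 6 * k ^ 2)%N.
  by move: k_gt0; rewrite !expnS !expn0; nia.
apply: (@leq_trans #|\bigcup_(z in support v) (inn z :|: \bigcup_(x in inn z) inn x)|).
  apply/subset_leq_card/subsetP => u; rewrite in_set -setI_eq0 => /set0Pn[z].
  rewrite in_setI => /andP[zv zu]; apply/bigcupP; exists z => //.
  move: zu; rewrite !in_setU => /orP[|/bigcupP[x ux xz]].
    by rewrite !inE => ->.
  apply/orP; right; apply/bigcupP; exists x; first by rewrite !inE in xz *.
  by rewrite !inE in ux *.
apply: leq_trans (leq_card_bigcup _ _) _.
apply: leq_trans (leq_sum _ (fun z _ => card_two_steps z le2k')) _.
rewrite sum_nat_const -mulnn; apply: (leq_mul _ le6).
exact: leq_trans (card_two_steps v le2k) le6.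
Qed.

(** Outside all bad events, degree excess and surplus total at most [j + (6 * j + 3)], less than the
    [8 * j + 10] reused classes. *)
Lemma dicolorable_of_sparse : dicolorable D k.
Proof.
have [||||||w wP] := @local_lemma R D {ffun 'I_m -> 'I_q.+1} D
    (fun v => bad_surplus v :|: bad_reuse v) support (2%:R * (4%:R^-1) ^+ j)
    ((6 * k ^ 2) ^ 2) depends_bad.
- move=> v; apply: (@le_trans _ _ (#|bad_surplus v|%:R + #|bad_reuse v|%:R)).
    by rewrite -natrD ler_nat leq_card_setU.
  have := bad_surplus_prob v; have := bad_reuse_prob v; lra.
- exact: support_overlap.
- rewrite exprVn mulrA -natrM mulrAC -natrX -!natrM ler_pdivrMr ?ltr0n ?expn_gt0 //.
  rewrite mul1r ler_nat; apply: leq_trans j_large.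
  apply: (@leq_trans (288 * k ^ 4)).
    by rewrite (_ : 288 * k ^ 4 = 4 * 2 * (6 * k ^ 2) ^ 2)%N ?leqnn //; ring.
  by rewrite leq_mul2l leq_exp2r // (ltnW k_lt) orbT.
- by rewrite mulr_ge0 ?exprn_ge0 ?invr_ge0.
- by rewrite expn_gt0 muln_gt0 expn_gt0 k_gt0.
- by rewrite card_ffun !card_ord expn_gt0.
apply: (@dicolorable_from_classes D m k (fun c => [set x | w x c == ord0])).
  apply: leq_trans Mj_le_k; rewrite leq_mul2r; apply/orP; right.
  by move: r2; rewrite !expnS !expn0; nia.
move=> v; have := wP v; rewrite in_setU negb_or !in_set -ltnNge -leqNgt => /andP[le1 le2].
rewrite (eq_bigr (fun x => #|[set c | w x c == ord0]|.-1)); last first.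
  by move=> x _; congr _.-1; apply: eq_card => c; rewrite !in_set.
apply: (@leq_trans (k + (8 * j + 10))); last by rewrite leq_add2l.
apply: (@leq_ltn_trans (k + j + (6 * j + 3))); last by lia.
by apply: leq_add; rewrite ?outdeg_le // -ltnS -addnS.
Qed.
End SparseColoring.

(** * Minimal counterexamples *)

(** The value of [r] comes from [k < 200 * (k %/ 200).+1]. With [j = k %/ M], the power [4 ^ j]
    eventually dominates the number of dependent events, of order [k ^ 4]. *)
Lemma sparse_threshold : exists M k0, (200 <= M) /\ forall (D : digraph) k,
    k0 <= k -> (forall v : D, #|outn v| <= k + k %/ M) ->
    (forall v : D, #|inn v| <= k + k %/ M) ->
    (forall v : D, (k %/ 200).+1 ^ 2 <= #|nondigon_pairs v|) ->
  dicolorable D k.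
Proof.
have [r [r3 rP]] : exists r, 3 <= r /\ forall k, 576 * k ^ 2 <= r * (k %/ 200).+1 ^ 2.
  exists (576 * 200 ^ 2); split.
    have : 0 < 200 ^ 2 by rewrite expn_gt0.
    by move: (200 ^ 2) => x; lia.
  move=> k; rewrite -mulnA -expnMn leq_mul2l leq_exp2r //.
  by rewrite mulnC; apply/orP; right; apply/ltnW/ltn_ceil.
have M_ge : 200 <= 36 * r ^ 2 by move: r3; rewrite !expnS expn0; nia.
have [j0 j0P] := exp4_dominates (288 * (36 * r ^ 2) ^ 4).
exists (36 * r ^ 2), (36 * r ^ 2 * j0.+1); split=> // D k k0k od id sp.
have le_j : j0 < k %/ (36 * r ^ 2).
  by rewrite leq_divRL ?(leq_trans _ M_ge) // mulnC.
apply: (@dicolorable_of_sparse rat D k (k %/ (36 * r ^ 2)) ((k %/ 200).+1 ^ 2) r) => //.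
- exact: ltnW.
- exact: leq_ltn_trans le_j.
- by rewrite mulnC leq_trunc_div.
- by rewrite mulnC ltn_ceil // (leq_trans _ M_ge).
- by rewrite expnMn mulnA; apply: j0P; apply: ltnW.
Qed.

Lemma critical_reduction : exists M k0, 0 < M /\ forall (D : digraph) k,
    k0 <= k ->
    (forall v : D, k <= #|outn v| <= k + k %/ M) ->
    (forall v : D, k <= #|inn v| <= k + k %/ M) ->
    (forall K : {set D}, K != set0 -> exists f : D -> 'I_k, dicoloring (~: K) f) ->
    ~~ dicolorable D k ->
  exists I : {set D}, [/\ acyclic_in I,
      forall v, v \notin I -> meets I (outn v) && meets I (inn v) &
      forall B : {set D}, biclique B -> [disjoint B & I] -> #|B| < biclique_number D].
Proof.
have [M [k0 [M_ge sparseP]]] := sparse_threshold.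
(* From [200 * t <= k] and [100 <= k] follows [100 * t + 50 <= k], as the case of large bicliques
   requires. *)
exists M, (k0 + 100); split; first exact: leq_trans M_ge.
move=> D k k0k od id crit ncol; set t := k %/ 200.
have tk : 200 * t <= k by rewrite mulnC leq_trunc_div.
have le_t : k %/ M <= t by apply: leq_div2l.
have odt (v : D) : k <= #|outn v| <= k + t.
  by have /andP[-> le] := od v; apply: leq_trans le _; rewrite leq_add2l.
have idt (v : D) : k <= #|inn v| <= k + t.
  by have /andP[-> le] := id v; apply: leq_trans le _; rewrite leq_add2l.
have [small|large] := leqP (biclique_number D + 9 * t + 4) k.
  case/negP: (ncol); apply: sparseP; first by lia.
  - by move=> v; have /andP[] := od v.
  - by move=> v; have /andP[] := id v.
  - by apply: (many_nondigon_pairs odt crit small) => //; lia.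
apply: (exists_maximal_acyclic odt idt large); lia.
Qed.

(** * Induced subdigraphs and dicolorings *)

Section Induced.
Variables (D : digraph) (S : {set D}).
Implicit Types (u v : induced S) (T : {set induced S}).

Lemma acyclic_in_induced T : acyclic_in T -> acyclic_in (val @: T : {set D}).
Proof.
move=> acT c c0 uc cT.
have Ec : map val (pmap (insub : D -> option {v | v \in S}) c) = c.
  by apply: map_val_insub; apply/allP => x /cT /imsetP[u _ ->]; apply: valP.
have := acT (pmap insub c).
rewrite -[cycle _ _](cycle_map (f := val) (e' := @arc D)) Ec; apply.
- by apply: contra c0 => /eqP E; rewrite -Ec E.
- by rewrite -(map_inj_uniq val_inj) Ec.
- move=> u uc'; have : val u \in c by rewrite -Ec map_f.
  by move=> /cT /imsetP[u' u'T /val_inj->].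
Qed.

Lemma outdeg_induced u : outdeg u = #|outn (val u) :&: S|.
Proof.
rewrite /outdeg -(card_imset _ val_inj); apply: eq_card => x.
rewrite in_setI; apply/imsetP/andP => [[w + ->]|[ux xS]].
  by rewrite !inE => uw; split; [|exact: valP].
by exists (Sub x xS) => //; rewrite !inE in ux *.
Qed.

Lemma indeg_induced u : indeg u = #|inn (val u) :&: S|.
Proof.
rewrite /indeg -(card_imset _ val_inj); apply: eq_card => x.
rewrite in_setI; apply/imsetP/andP => [[w + ->]|[ux xS]].
  by rewrite !inE => uw; split; [|exact: valP].
by exists (Sub x xS) => //; rewrite !inE in ux *.
Qed.

Lemma card_induced : #|induced S| = #|S|.
Proof. by rewrite card_sig; apply: eq_card => x; rewrite inE. Qed.

Lemma biclique_induced (B : {set induced S}) :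
  biclique B -> biclique (val @: B : {set D}).
Proof.
move=> /bicliqueP bB; apply/bicliqueP => _ _ /imsetP[u uB ->] /imsetP[v vB ->] uv.
by apply: bB => //; apply: contraNneq uv => ->.
Qed.

Lemma biclique_number_attained : exists2 B : {set D}, biclique B & #|B| = biclique_number D.
Proof.
have [|B bB E] := @eq_bigmax_cond _ [pred B : {set D} | biclique B] (fun B => #|B|).
  by apply/card_gt0P; exists set0; apply/bicliqueP => x y; rewrite inE.
by exists B.
Qed.

Lemma exists_dicoloring_induced k :
  0 < k -> dicolorable (induced S) k -> exists f : D -> 'I_k, dicoloring S f.
Proof.
move=> k0 /dicolorableP[g gP].
(* Vertices outside [S] get a dummy color; [0 < k] provides it. *)
exists (fun x => if insub x is Some u then g u else Ordinal k0) => i.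
apply: acyclic_inS (acyclic_in_induced (gP i)); apply/subsetP => x.
rewrite inE => /andP[xS]; rewrite insubT => gx; apply/imsetP.
by exists (Sub x xS) => //; rewrite !inE.
Qed.
End Induced.

Lemma dicolorable_acyclic_part (D : digraph) (I : {set D}) k :
  acyclic_in I -> dicolorable (induced (~: I)) k -> dicolorable D k.+1.
Proof.
move=> acI /dicolorableP[g gP]; apply/dicolorableP.
exists (fun x => if insub x is Some u then lift ord_max (g u) else ord_max) => i.
case: (unliftP ord_max i) => [i'|] ->.
  apply: acyclic_inS (acyclic_in_induced (gP i')); apply/subsetP => x.
  rewrite !inE /=; case: insubP => [u _ <- /eqP/lift_inj gu|_]; last first.
    by rewrite (negPf (neq_lift _ _)).
  by apply/imsetP; exists u; rewrite // !inE gu eqxx.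
apply: acyclic_inS acI; apply/subsetP => x; rewrite !inE /=.
case: insubP => [u _ _|]; first by rewrite eq_sym (negPf (neq_lift _ _)).
by rewrite inE negbK.
Qed.

Lemma dicolorable_le (D : digraph) k l : k <= l -> dicolorable D k -> dicolorable D l.
Proof.
move=> kl /dicolorableP[f fP]; apply/dicolorableP.
exists (fun x => widen_ord kl (f x)) => i.
have [x /eqP <-|no] := pickP (fun x => widen_ord kl (f x) == i); last first.
  by apply: (acyclic_inS _ (@acyclic_in0 D)); apply/subsetP => x; rewrite !inE no.
apply: acyclic_inS (fP (f x)); apply/subsetP => y; rewrite !inE => /eqP.
by move=> /(congr1 val) /= E; apply/eqP/val_inj.
Qed.

Lemma dichromatic_number_le (D : digraph) k : (dichromatic_number D <= k) = dicolorable D k.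
Proof.
rewrite /dichromatic_number; case: ex_minnP => n nP n_min.
by apply/idP/idP => [/dicolorable_le|/n_min]; [apply|].
Qed.

(** A color missing from one of the two neighbourhoods of [v] would extend [f] to [v]. *)
Lemma critical_degree (D : digraph) k v (f : D -> 'I_k) :
    dicoloring (~: [set v]) f -> ~~ dicolorable D k ->
  (k <= #|outn v|) && (k <= #|inn v|).
Proof.
move=> fP ncol.
have full (g : D -> 'I_k) : dicoloring (v |: ~: [set v]) g -> dicolorable D k.
  by rewrite setUCr => gP; apply/dicolorableP; exists g.
apply/andP; split; rewrite leqNgt; apply: contra ncol => lt.
- have [|i iP] := @exists_free_color k (f @: outn v).
    exact: leq_ltn_trans (leq_imset_card _ _) lt.
  apply: (full (recolor f v i)); apply: dicoloring_add => //; first by rewrite !inE eqxx.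
  by left=> x _ vx; apply: contraNneq iP => <-; rewrite imset_f // inE.
- have [|i iP] := @exists_free_color k (f @: inn v).
    exact: leq_ltn_trans (leq_imset_card _ _) lt.
  apply: (full (recolor f v i)); apply: dicoloring_add => //; first by rewrite !inE eqxx.
  by right=> x _ vx; apply: contraNneq iP => <-; rewrite imset_f // inE.
Qed.

(** * Geometric degree and the bound under vertex deletion *)

Section GeometricDegree.
Variable R : realType.
Local Open Scope ring_scope.
Implicit Types (D : digraph).

Lemma max_geom_deg_ge D (v : D) :
  Num.sqrt (outdeg v * indeg v)%N%:R <= max_geom_deg R D.
Proof. exact: le_bigmax. Qed.

Lemma max_geom_deg_ge0 D : 0 <= max_geom_deg R D.
Proof. exact: bigmax_ge_id. Qed.

Lemma max_geom_deg_le D (x : R) : 0 <= x ->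
    (forall v : D, Num.sqrt (outdeg v * indeg v)%N%:R <= x) ->
  max_geom_deg R D <= x.
Proof. by move=> x0 vx; apply: bigmax_le => // v _. Qed.

Lemma max_geom_deg_induced D (S : {set D}) :
  max_geom_deg R (induced S) <= max_geom_deg R D.
Proof.
apply: max_geom_deg_le (max_geom_deg_ge0 D) _ => u.
apply: le_trans (max_geom_deg_ge (val u)); rewrite ler_wsqrtr // ler_nat.
rewrite outdeg_induced indeg_induced; apply: leq_mul;
  by rewrite subset_leq_card ?subsetIl.
Qed.

Lemma biclique_number_induced D (S : {set D}) :
  (biclique_number (induced S) <= biclique_number D)%N.
Proof.
have [B bB <-] := biclique_number_attained (induced S).
rewrite -(card_imset _ val_inj); exact: biclique_numberP (biclique_induced bB).
Qed.

(** Each remaining vertex loses an arc in both directions, and [(a - 1) * (b - 1) <= (sqrt (a * b) -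
    1) ^ 2] by the inequality of means. [1 <= max_geom_deg R D] covers the default value 0 of the
    maximum. *)
Lemma max_geom_deg_remove D (I : {set D}) :
    1 <= max_geom_deg R D ->
    (forall v, v \notin I -> meets I (outn v) && meets I (inn v)) ->
  max_geom_deg R (induced (~: I)) <= max_geom_deg R D - 1.
Proof.
move=> s1 hit; apply: max_geom_deg_le => [|u]; first by rewrite subr_ge0.
have uI : val u \notin I by have := valP u; rewrite inE.
have /andP[/set0Pn[x] + /set0Pn[y]] := hit _ uI.
rewrite !in_setI => /andP[xI ux] /andP[yI uy].
have lto : (outdeg u < outdeg (val u))%N.
  rewrite outdeg_induced -setDE; apply/proper_card/properP; split; first exact: subsetDl.
  by exists x; rewrite // in_setD xI.
have lti : (indeg u < indeg (val u))%N.
  rewrite indeg_induced -setDE; apply/proper_card/properP; split; first exact: subsetDl.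
  by exists y; rewrite // in_setD yI.
have := max_geom_deg_ge (val u); set g := Num.sqrt _ => gs.
have g2 : g ^+ 2 = (outdeg (val u))%:R * (indeg (val u))%:R.
  by rewrite sqr_sqrtr // natrM.
have g0 : 0 <= g by exact: sqrtr_ge0.
move: lto lti; rewrite -!(ler_nat R) -!natr1 => lto lti.
have o0 : 0 <= (outdeg u)%:R :> R by [].
have i0 : 0 <= (indeg u)%:R :> R by [].
move: g2 lto lti; set a := (outdeg u)%:R in o0 *; set b := (indeg u)%:R in i0 *.
set a' := (outdeg _)%:R; set b' := (indeg _)%:R => g2 la lb.
have g1 : 1 <= g.
  rewrite -(ler_pXn2r (n := 2)) ?nnegrE // expr1n g2; nra.
suff : Num.sqrt (outdeg u * indeg u)%N%:R <= g - 1 by lra.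
rewrite -(ler_pXn2r (n := 2)) ?nnegrE ?sqrtr_ge0 ?subr_ge0 //.
rewrite sqr_sqrtr // natrM -/a -/b.
have amgm : 2%:R * g <= a' + b'.
  rewrite -(ler_pXn2r (n := 2)) ?nnegrE ?mulr_ge0 //; last by lra.
  by rewrite exprMn g2; have := sqr_ge0 (a' - b'); rewrite !expr2; lra.
apply: (@le_trans _ _ ((a' - 1) * (b' - 1))).
  by apply: ler_pM => //; lra.
by move: g2; rewrite !expr2; lra.
Qed.

Definition reed_bound (e : R) D : R :=
  (1 - e) * (max_geom_deg R D + 1) + e * (biclique_number D)%:R.

Lemma reed_bound_induced e D (S : {set D}) : 0 <= e -> e <= 1 ->
  reed_bound e (induced S) <= reed_bound e D.
Proof.
move=> e0 e1; apply: lerD; apply: ler_wpM2l; rewrite ?subr_ge0 //.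
  by rewrite lerD2r max_geom_deg_induced.
by rewrite ler_nat biclique_number_induced.
Qed.

Lemma reed_bound_remove e D (I : {set D}) : 0 <= e -> e <= 1 ->
    1 <= max_geom_deg R D ->
    (forall v, v \notin I -> meets I (outn v) && meets I (inn v)) ->
    (forall B : {set D}, biclique B -> [disjoint B & I] -> #|B| < biclique_number D)%N ->
  reed_bound e (induced (~: I)) <= reed_bound e D - 1.
Proof.
move=> e0 e1 s1 hit hitB; rewrite /reed_bound.
have := max_geom_deg_remove s1 hit.
have : (biclique_number (induced (~: I)) < biclique_number D)%N.
  have [B bB <-] := biclique_number_attained (induced (~: I)).
  rewrite -(card_imset _ val_inj); apply: hitB (biclique_induced bB) _.
  rewrite disjoint_sym disjoints_subset; apply/subsetP => x xI; rewrite inE.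
  by apply/imsetP => -[u _ E]; have := valP u; rewrite -E inE xI.
rewrite -(ler_nat R) -natr1 => leB leS.
have := ler_wpM2l e0 leB; have := ler_wpM2l (_ : 0 <= 1 - e) leS.
by rewrite subr_ge0 e1 => /(_ isT); lra.
Qed.
End GeometricDegree.

(** * Degrees in a minimal counterexample *)

Section DegreeWindow.
Variables (R : realType) (D : digraph) (e : R) (k M k0 : nat).
Local Open Scope ring_scope.
Local Notation s := (max_geom_deg R D).
Hypothesis M_gt0 : (0 < M)%N.
Hypothesis eE : e = (2 * (M + k0 + 1))%:R^-1.
Hypothesis ge_bound : reed_bound e D <= k%:R.
Hypothesis crit : forall v : D, (k <= #|outn v|)%N && (k <= #|inn v|)%N.
Variable v0 : D.

Let e_gt0 : 0 < e. Proof. by rewrite eE invr_gt0 ltr0n muln_gt0 addn1. Qed.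

Let e_mul : e * (2%:R * (M%:R + k0%:R + 1)) = 1.
Proof. by rewrite eE natrM !natrD mulVf // -!natrD -natrM pnatr_eq0 muln_eq0 addn1. Qed.

Let e_le : 2%:R * e <= 1.
Proof.
have := e_mul; have := e_gt0; have := ler0n R M; have := ler0n R k0.
by move=> a b c d; nra.
Qed.

Lemma le_max_geom_deg : k%:R <= s.
Proof.
apply: le_trans (max_geom_deg_ge R v0); have /andP[ko ki] := crit v0.
rewrite -[leLHS]ger0_norm // -sqrtr_sqr ler_wsqrtr // -natrX ler_nat -mulnn.
exact: leq_mul.
Qed.

Let bound_ge : (1 - e) * (s + 1) <= k%:R.
Proof. by apply: le_trans ge_bound; rewrite lerDl mulr_ge0 // ltW. Qed.

(** From [(1 - e) * (s + 1) <= k <= s] follows [e * (s + 1) >= 1], hence [k >= (1 - e) / e >= 1 / (2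
    * e) = M + k0 + 1]. *)
Lemma large_degree : (k0 <= k)%N.
Proof.
have ks := le_max_geom_deg; have bs := bound_ge.
have es : 1 <= e * (s + 1) by lra.
have le1 : 2%:R^-1 <= e * k%:R.
  have := ler_wpM2l (ltW e_gt0) bs.
  have : e * ((1 - e) * (s + 1)) = (1 - e) * (e * (s + 1)) by ring.
  have : 0 <= 1 - e by have := e_le; lra.
  move=> e1 -> le; apply: le_trans le.
  have := ler_wpM2l e1 es; have := e_le; lra.
rewrite -(ler_nat R) -(ler_pM2l e_gt0); apply: le_trans le1.
have := e_mul; have := mulr_ge0 (ltW e_gt0) (ler0n R M); have := e_gt0; lra.
Qed.

(** As [a * k <= s ^ 2] and [(1 - e) * s <= k], one gets [(1 - e) ^ 2 * a <= k]; and
    [2 * e * (M + 1) <= 1] gives [M <= (M + 1) * (1 - e) ^ 2]. *)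
Lemma degree_window (a b : nat) : (k <= a)%N -> (k <= b)%N -> (a * b)%:R <= s ^+ 2 ->
  (a <= k + k %/ M)%N.
Proof.
move=> ka kb ab.
suff : (M * a <= M.+1 * k)%N.
  move=> le; rewrite -leq_subLR leq_divRL // mulnBl leq_subLR addnC -mulnS.
  by rewrite mulnC [(k * _)%N]mulnC.
have [k_eq0|k_gt0] := posnP k.
  have : s + 1 <= 0.
    by move: bound_ge; rewrite k_eq0 pmulr_rle0 //; have := e_le; lra.
  by have := max_geom_deg_ge0 R D; lra.
have e1 : 0 <= 1 - e by have := e_le; lra.
have s0 := max_geom_deg_ge0 R D.
have le1 : ((1 - e) * s) ^+ 2 <= k%:R ^+ 2.
  rewrite ler_pXn2r ?nnegrE ?mulr_ge0 //; apply: le_trans bound_ge.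
  by rewrite ler_wpM2l // lerDl.
have le2 : (1 - e) ^+ 2 * (a%:R * k%:R) <= k%:R * k%:R.
  rewrite -expr2; apply: le_trans le1; rewrite exprMn ler_wpM2l ?exprn_ge0 //.
  by apply: le_trans ab; rewrite -natrM ler_nat leq_mul2l kb orbT.
have k_pos : (0 : R) < k%:R by rewrite ltr0n.
have le3 : (1 - e) ^+ 2 * a%:R <= k%:R by rewrite mulrA ler_pM2r in le2.
have le4 : M%:R <= (M%:R + 1) * (1 - e) ^+ 2.
  have Mk : 2%:R * e * (M%:R + 1) <= 1.
    by have := e_mul; have := mulr_ge0 (ltW e_gt0) (ler0n R k0); lra.
  have : 0 <= (M%:R + 1) * e ^+ 2 by rewrite mulr_ge0 ?exprn_ge0 ?(ltW e_gt0) ?addr_ge0.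
  rewrite !expr2; lra.
rewrite -(ler_nat R) !natrM -natr1.
apply: (@le_trans _ _ ((M%:R + 1) * (1 - e) ^+ 2 * a%:R)); first by rewrite ler_wpM2r.
rewrite -mulrA; apply: ler_wpM2l le3.
by rewrite addr_ge0.
Qed.

End DegreeWindow.

Unset Implicit Arguments.
Local Open Scope ring_scope.

Theorem theorem1p7 (R : realType) :
  exists2 epsilon : R, 0 < epsilon &
    forall D : digraph,
      (dichromatic_number D)%:Z <=
        Num.ceil ((1 - epsilon) * (max_geom_deg R D + 1)
                  + epsilon * (biclique_number D)%:R).
Proof.
have [M [k0 [M_gt0 reduction]]] := critical_reduction.
set e : R := (2 * (M + k0 + 1))%:R^-1.
have e_gt0 : 0 < e by rewrite invr_gt0 ltr0n muln_gt0 addn1.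
have e_lt1 : e < 1.
  by rewrite invf_lt1 ?ltr1n ?ltr0n ?muln_gt0 ?addn1 // mulnS leq_addr.
exists e => // D; rewrite -/(reed_bound e D).
(* The bound is positive even for the empty digraph, so there is always a color to spare for an
   acyclic part. *)
have ceilE (D' : digraph) : exists k, Num.ceil (reed_bound e D') = k.+1%:Z.
  have : 0 < Num.ceil (reed_bound e D').
    rewrite ceil_gt0 /reed_bound ltr_wpDr ?mulr_ge0 ?(ltW e_gt0) //.
    by rewrite mulr_gt0 ?subr_gt0 // ltr_wpDl // max_geom_deg_ge0.
  by case: (Num.ceil _) => [[|k]|] // _; exists k.
have [n] := ubnP #|D|; elim: n D => // n IH D ltn.
have [k kE] := ceilE D; rewrite kE lez_nat dichromatic_number_le.
apply: contraT => ncol.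
have IHS (S : {set D}) l : (#|S| < #|D|)%N -> reed_bound e (induced S) <= l%:R ->
    dicolorable (induced S) l.
  move=> ltS leb; rewrite -dichromatic_number_le -lez_nat.
  apply: le_trans (IH _ _) _; first by rewrite card_induced; exact: leq_trans ltS _.
  by rewrite ceil_le_int.
have leb : reed_bound e D <= k.+1%:R by have := ceil_ge (reed_bound e D); rewrite kE.
have crit (K : {set D}) : K != set0 -> exists f : D -> 'I_k.+1, dicoloring (~: K) f.
  move=> K0; apply: exists_dicoloring_induced => //; apply: IHS.
    by rewrite -(cardsC K) -[X in (X < _)%N]add0n ltn_add2r card_gt0.
  by apply: le_trans leb; apply: reed_bound_induced; rewrite ltW.
have deg (v : D) : (k.+1 <= #|outn v|)%N && (k.+1 <= #|inn v|)%N.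
  have [|f fP] := crit [set v]; first by rewrite -card_gt0 cards1.
  exact: critical_degree fP ncol.
have [v0 _|D0] := pickP (fun _ : D => true); last first.
  case/negP: ncol; apply: (@greedy_dicoloring D _ setT (fun=> ord0)) => [i|v].
    by apply: (acyclic_inS _ (@acyclic_in0 D)); apply/subsetP => x; have := D0 x.
  by have := D0 v.
have prod_le (v : D) : (#|outn v| * #|inn v|)%:R <= max_geom_deg R D ^+ 2 :> R.
  rewrite -[leLHS]sqr_sqrtr // ler_pXn2r ?nnegrE ?sqrtr_ge0 ?max_geom_deg_ge0 //.
  exact: max_geom_deg_ge.
have [|v|v|I [acI hit hitB]] := reduction D k.+1 _ _ _ crit ncol.
- exact: (large_degree (erefl e) leb deg v0).
- have /andP[-> ki] := deg v.
  by apply: (degree_window M_gt0 (erefl e) leb _ ki (prod_le v)) => //; have /andP[] := deg v.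
- have /andP[ko ->] := deg v.
  apply: (degree_window M_gt0 (erefl e) leb _ ko); first by have /andP[] := deg v.
  by rewrite mulnC.
case/negP: ncol; apply: (dicolorable_acyclic_part acI); apply: IHS.
  (* If [I] were empty, [v0] would lie outside [I] and so have a neighbour in it. *)
  have : (0 < #|I|)%N.
    rewrite card_gt0; apply: contraT; rewrite negbK => /eqP I0.
    by have := hit v0; rewrite I0 /meets !set0I eqxx inE => /(_ isT).
  by move=> I_gt0; rewrite -(cardsC I) -[X in (X < _)%N]add0n ltn_add2r.
have s1 : 1 <= max_geom_deg R D.
  by apply: le_trans (le_max_geom_deg R deg v0); rewrite ler1n.
apply: le_trans (reed_bound_remove (ltW e_gt0) (ltW e_lt1) s1 hit hitB) _.
by rewrite lerBlDr natr1.
Qed.
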